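(* Let $\mathfrak g$ be an untwisted affine Kac--Moody Lie algebra and let $\lambda\in\mathcal P^+$ be a regular dominant integral weight with $\langle\lambda,d\rangle=0$. Then the set of vertices of the dominant weight polyhedron $D_\lambda$ is equal to $\{\hat b_H(\lambda)\}_{H\subsetneq I}$, where $H$ ranges over all proper subsets of $I$ (including $\varnothing$).
   Context: $\mathfrak g$ is the untwisted affine Kac--Moody Lie algebra (conventions of Kac's book) of a finite-dimensional simple complex Lie algebra of rank $l$, with Cartan subalgebra $\mathfrak h$, derivation $d\in\mathfrak h$, $I=\{0,1,\dots,l\}$, simple roots $\alpha_i$, simple coroots $\alpha_i^\vee$, simple reflections $s_i$ generating the Weyl group $W$, basic imaginary root $\delta$. $\mathcal P^+=\{\lambda\in\mathfrak h^*:\langle\lambda,\alpha_i^\vee\rangle\in\mathbb Z_{\ge0}\ \forall i\in I\}$; $\lambda$ is regular dominant if $\langle\lambda,\alpha_i^\vee\rangle>0$ for all $i\in I$. Fundamental weights: $\langle\Lambda_i,\alpha_j^\vee\rangle=\delta_{ij}$, $\langle\Lambda_i,d\rangle=0$. $\mathfrak h^*_{\mathbb Q}=\bigoplus_{i\in I}\mathbb Q\Lambda_i\oplus\mathbb Q\delta$, and $\mathcal C_{\mathbb Q}=\{\mu\in\mathfrak h^*_{\mathbb Q}:\langle\mu,\alpha_i^\vee\rangle\ge0\ \forall i\in I\}$. Dominant weight polyhedron: $D_\lambda=\mathcal C_{\mathbb Q}\cap\operatorname{conv}_{\mathbb Q}\{w\lambda:w\in W\}$, where $\operatorname{conv}_{\mathbb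 Q}$ is the rational convex hull. It is a rational polyhedron; its vertices are its zero-dimensional faces. For $H\subsetneq I$, $W_H=\langle s_j:j\in H\rangle\subset W$ (a finite group) and $\hat b_H(\lambda)=\frac1{|W_H|}\sum_{w\in W_H}w(\lambda)$. *)

(* Defs.v *)
From HB Require Import structures.
From mathcomp Require Import all_boot all_order all_algebra.
From mathcomp Require Import finmap.
From mathcomp Require Import all_classical reals.
From mathcomp Require Import complex.

Set Implicit Arguments.
Unset Strict Implicit.
Unset Printing Implicit Defensive.

Import Order.TTheory GRing.Theory Num.Theory.
Local Open Scope classical_set_scope.
Local Open Scope ring_scope.

(* Throughout, Cartan matrices follow Kac: A i j = <alpha_i^vee, alpha_j>.    *)

Definition generalized_cartan_matrix (n : nat) (A : 'M[int]_n) : Prop :=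
  [/\ forall i, A i i = 2,
      forall i j, i != j -> A i j <= 0
    & forall i j, A i j = 0 -> A j i = 0].

Definition indecomposable_matrix (n : nat) (A : 'M[int]_n) : Prop :=
  (0 < n)%N /\
  forall J : {set 'I_n}, (exists i, i \in J) -> (exists j, j \notin J) ->
    exists i j, [/\ i \in J, j \notin J & A i j != 0].

Definition positive_definite_symmetrizable (n : nat) (A : 'M[int]_n) : Prop :=
  exists e : 'I_n -> rat,
    [/\ forall i, 0 < e i,
        forall i j, e i * (A i j)%:~R = e j * (A j i)%:~R
      & forall x : 'I_n -> rat, (exists i, x i != 0) ->
          0 < \sum_i \sum_j x i * (e i * (A i j)%:~R) * x j].

(* The Cartan matrices of the finite-dimensional simple Lie algebras.         *)
Definition simple_cartan_matrix (l : nat) (A : 'M[int]_l) : Prop :=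
  [/\ generalized_cartan_matrix A, indecomposable_matrix A
    & positive_definite_symmetrizable A].

(* [root_coroot A b bv]: b is a root and bv = b^vee its coroot, written in    *)
(* the bases of simple roots and of simple coroots: the pairs                 *)
(* (w alpha_i, w alpha_i^vee) with w in the finite Weyl group.                *)
Inductive root_coroot (l : nat) (A : 'M[int]_l) :
    'cV[int]_l -> 'cV[int]_l -> Prop :=
| RootSimple (i : 'I_l) : root_coroot A (delta_mx i 0) (delta_mx i 0)
| RootReflect (i : 'I_l) (b bv : 'cV[int]_l) : root_coroot A b bv ->
    root_coroot A (b - (A *m b) i 0 *: delta_mx i 0)
                  (bv - (A^T *m bv) i 0 *: delta_mx i 0).

Definition highest_root (l : nat) (A : 'M[int]_l) (theta thetav : 'cV[int]_l)
    : Prop :=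
  root_coroot A theta thetav /\
  forall b bv, root_coroot A b bv -> forall i, b i 0 <= theta i 0.

(* The matrix X_l^(1): alpha_0 = delta - theta and alpha_0^vee = K - theta^vee, *)
(* where delta and K pair to zero with all simple coroots, resp. roots; index *)
(* 0 is [lshift l 0] and index i >= 1 is [rshift 1 i].                        *)
Definition untwisted_affine_matrix (l : nat) (A : 'M[int]_l)
    (theta thetav : 'cV[int]_l) : 'M[int]_(1 + l) :=
  block_mx (2%:M) (- (thetav^T *m A)) (- (A *m theta)) A.

Section KacMoody.
Variable C : numFieldType.

Definition lie_bracket (g : lmodType C) (br : g -> g -> g) : Prop :=
  [/\ forall a x y z, br (a *: x + y) z = a *: br x z + br y z,
      forall a x y z, br z (a *: x + y) = a *: br z x + br z y,
      forall x, br x x = 0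
    & forall x y z, br x (br y z) + br y (br z x) + br z (br x y) = 0].

Definition linear_subset (g : lmodType C) (S : set g) : Prop :=
  S 0 /\ forall a x y, S x -> S y -> S (a *: x + y).

(* The Kac-Moody algebra g(A): a realization (h, roots, coroots) of A and the *)
(* Lie algebra generated by h and Chevalley generators with no nonzero ideal  *)
(* meeting h trivially, which characterizes g(A) (Kac, Proposition 1.4).      *)
Record kac_moody (n : nat) (A : 'M[int]_n) := KacMoody {
  km_cartan : vectType C;
  km_coroot : 'I_n -> km_cartan;
  km_root : 'I_n -> 'Hom(km_cartan, C^o);
  km_coroot_free : free [seq km_coroot i | i <- enum 'I_n];
  km_root_free : free [seq km_root i | i <- enum 'I_n];
  km_pairing : forall i j, km_root j (km_coroot i) = (A i j)%:~R;
  km_dim : (\dim {: km_cartan} + \rank (map_mx (intr : int -> C) A) = n + n)%N;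
  km_lie : lmodType C;
  km_br : km_lie -> km_lie -> km_lie;
  km_brP : lie_bracket km_br;
  km_incl : {linear km_cartan -> km_lie};
  km_incl_inj : injective km_incl;
  km_e : 'I_n -> km_lie;
  km_f : 'I_n -> km_lie;
  km_brhh : forall x y, km_br (km_incl x) (km_incl y) = 0;
  km_brhe : forall x i,
    km_br (km_incl x) (km_e i) = (km_root i x : C) *: km_e i;
  km_brhf : forall x i,
    km_br (km_incl x) (km_f i) = - (km_root i x : C) *: km_f i;
  km_bref : forall i j,
    km_br (km_e i) (km_f j) = if i == j then km_incl (km_coroot i) else 0;
  km_gen : forall S : set km_lie, linear_subset S ->
    (forall x y, S x -> S y -> S (km_br x y)) ->
    (forall x, S (km_incl x)) -> (forall i, S (km_e i)) ->
    (forall i, S (km_f i)) -> forall x, S x;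
  km_ideal : forall S : set km_lie, linear_subset S ->
    (forall x y, S y -> S (km_br x y)) ->
    (forall x, S (km_incl x) -> x = 0) -> forall x, S x -> x = 0
}.

Section Weights.
Variables (n : nat) (A : 'M[int]_n) (g : kac_moody A).

Definition dual_cartan : vectType C := 'Hom(km_cartan g, C^o).

Definition pairing (mu : dual_cartan) (x : km_cartan g) : C := mu x.

Definition reflection_fun (i : 'I_n) (mu : dual_cartan) : dual_cartan :=
  mu - pairing mu (km_coroot g i) *: km_root g i.

Lemma reflection_fun_is_linear i : linear (reflection_fun i).
Proof.
move=> a u v; rewrite /reflection_fun /pairing add_lfunE scale_lfunE.
by rewrite scalerDl scalerBr scalerA opprD addrACA.
Qed.

HB.instance Definition _ i := GRing.isLinear.Build C dual_cartan dual_cartan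
  *:%R (reflection_fun i) (reflection_fun_is_linear i).

Definition reflection (i : 'I_n) : 'End(dual_cartan) :=
  linfun (reflection_fun i).

Definition weyl_word (js : seq 'I_n) : 'End(dual_cartan) :=
  foldr (fun j w => (reflection j \o w)%VF) \1%VF js.

(* W_H; the generators are involutions, so products of generators suffice.    *)
Definition parabolic (H : {set 'I_n}) : set 'End(dual_cartan) :=
  [set w | exists2 js : seq 'I_n, all (fun j => j \in H) js & w = weyl_word js].

Definition weyl_group : set 'End(dual_cartan) := parabolic finset.setT.

Definition weyl_orbit (lambda : dual_cartan) : set dual_cartan :=
  [set w lambda | w in weyl_group].

(* [fset_set] enumerates a finite set; W_H is finite for H proper, A affine.  *)
Definition bhat (H : {set 'I_n}) (lambda : dual_cartan) : dual_cartan :=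
  (#|` fset_set (parabolic H)|%:R : C)^-1 *:
    \sum_(w <- fset_set (parabolic H)) (w : 'End(dual_cartan)) lambda.

Definition dominant_integral (lambda : dual_cartan) : Prop :=
  forall i, exists m : nat, pairing lambda (km_coroot g i) = m%:R.

Definition regular_dominant (lambda : dual_cartan) : Prop :=
  forall i, 0 < pairing lambda (km_coroot g i).

Definition fundamental_weights (d : km_cartan g) (Lam : 'I_n -> dual_cartan)
    : Prop :=
  (forall i j, pairing (Lam i) (km_coroot g j) = (i == j)%:R) /\
  (forall i, pairing (Lam i) d = 0).

Definition rational_weights (Lam : 'I_n -> dual_cartan) (delta : dual_cartan)
    : set dual_cartan :=
  [set mu | exists (c : 'I_n -> rat) (b : rat),
    mu = \sum_i (ratr (c i) : C) *: Lam i + (ratr b : C) *: delta].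

(* The cone C_Q, for U = h^*_Q.                                               *)
Definition rational_dominant (U : set dual_cartan) : set dual_cartan :=
  [set mu | U mu /\ forall i, 0 <= pairing mu (km_coroot g i)].

End Weights.

Definition conv_rat (V : lmodType C) (S : set V) : set V :=
  [set v | exists (m : nat) (c : 'I_m -> rat) (x : 'I_m -> V),
    [/\ forall k, 0 <= c k, \sum_k c k = 1, forall k, S (x k)
      & v = \sum_k (ratr (c k) : C) *: x k]].

Definition rational_linear_on (V : lmodType C) (U : set V) (f : V -> rat)
    : Prop :=
  forall a u v, U u -> U v -> f ((ratr a : C) *: u + v) = a * f u + f v.

(* Nonempty faces of a polyhedron P in the rational vector space U: the loci  *)
(* where a Q-linear functional on U attains its maximum on P (f = 0 gives P). *)
Definition is_face (V : lmodType C) (U P F : set V) : Prop :=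
  F !=set0 /\
  exists (f : V -> rat) (c : rat),
    [/\ rational_linear_on U f, forall x, P x -> f x <= c
      & F = P `&` [set x | f x = c]].

(* A face has dimension zero when it is a single point.                       *)
Definition vertices (V : lmodType C) (U P : set V) : set V :=
  [set v | is_face U P [set v]].

Definition dominant_weight_polyhedron (n : nat) (A : 'M[int]_n)
    (g : kac_moody A) (U : set (dual_cartan g)) (lambda : dual_cartan g)
    : set (dual_cartan g) :=
  rational_dominant U `&` conv_rat (weyl_orbit lambda).

(* delta = alpha_0 + theta.                                                   *)
Definition basic_imaginary_root (l : nat) (A : 'M[int]_l)
    (theta thetav : 'cV[int]_l)
    (g : kac_moody (untwisted_affine_matrix A theta thetav)) : dual_cartan g :=
  km_root g (lshift l 0) +
  \sum_(i < l) ((theta i 0)%:~R : C) *: km_root g (rshift 1 i).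

(* The defining property of the derivation d in Kac's conventions.            *)
Definition is_derivation_element (l : nat) (A : 'M[int]_(1 + l))
    (g : kac_moody A) (d : km_cartan g) : Prop :=
  forall i : 'I_(1 + l), pairing (km_root g i) d = (i == lshift l 0)%:R.

End KacMoody.

(* Main.v *)
(** Write a weight as lambda - sum_j c_j alpha_j.  Orbit points have c >= 0, so
    D_lambda lies in the polyhedron {c >= 0, S c <= p}, where S is a symmetrized
    affine Cartan matrix and p the correspondingly scaled vector of pairings of
    lambda with the simple coroots.  As S is a singular M-matrix, its proper
    principal submatrices are inverse-monotone; hence, for H proper, there is
    exactly one point with c = 0 off H and S c = p on H, it lies in this
    polyhedron, and the sum of the slacks of these constraints exposes it.  This
    point is bhat_H(lambda).

    Conversely let f be maximal on D_lambda exactly at v.  If delta - alpha_i is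
    a root b, then lambda - k delta is the midpoint of s_i s_b lambda and
    s_b s_i lambda for some k > 0, so D_lambda is stable under subtracting
    k delta and f(delta) >= 0.  This makes the linear complementarity problem
    for S with data f(alpha_j) solvable, and a solution with support H certifies
    that f is maximal at bhat_H(lambda), whence v = bhat_H(lambda).

    The inclusion c >= 0 for orbit points follows from the exchange argument for
    words in W and the sign-coherence of real roots. *)
Require Import Defs.
From HB Require Import structures.
From mathcomp Require Import all_boot all_order all_algebra.
From mathcomp Require Import finmap.
From mathcomp Require Import all_classical reals.
From mathcomp Require Import complex.
From mathcomp Require Import zify ring lra.

Set Implicit Arguments.
Unset Strict Implicit.
Unset Printing Implicit Defensive.

Import Order.TTheory GRing.Theory Num.Theory.
Local Open Scope classical_set_scope.
Local Open Scope ring_scope.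

(** * Column vectors and Z-matrices *)

Lemma properTP (T : finType) (B : {set T}) :
  reflect (exists x, x \notin B) (B \proper T).
Proof.
apply: (iffP properP) => [[_ [x _ xB]]|[x xB]]; first by exists x.
by split; [exact/fintype.subsetP|exists x].
Qed.

Lemma proper_setC1 (T : finType) (x : T) : [set~ x]%SET \proper T.
Proof. by apply/properTP; exists x; rewrite !inE eqxx. Qed.

Section DotProduct.
Variables (T : comNzRingType) (n : nat).
Implicit Types (M : 'M[T]_n) (x y z : 'cV[T]_n).

Definition dot x y : T := \sum_i x i 0 * y i 0.

Lemma dotC x y : dot x y = dot y x.
Proof. by apply: eq_bigr => i _; rewrite mulrC. Qed.

Lemma dot_is_scalar x : scalar (dot x).
Proof.
move=> t y z; rewrite /dot mulr_sumr -big_split; apply: eq_bigr => i _ /=.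
by rewrite !mxE mulrDr mulrCA.
Qed.

HB.instance Definition _ x :=
  GRing.isLinear.Build T 'cV[T]_n T *%R (dot x) (dot_is_scalar x).

Lemma dotDl x y z : dot (x + y) z = dot x z + dot y z.
Proof. by rewrite dotC linearD /= !(dotC z). Qed.

Lemma dotZl t x y : dot (t *: x) y = t * dot x y.
Proof. by rewrite dotC linearZ /= dotC. Qed.

Lemma dotBl x y z : dot (x - y) z = dot x z - dot y z.
Proof. by rewrite dotDl -scaleN1r dotZl mulN1r. Qed.

Lemma dot_deltal i x : dot (delta_mx i 0) x = x i 0.
Proof.
rewrite /dot (bigD1 i) //= mxE !eqxx mul1r big1 ?addr0 // => j /negPf ji.
by rewrite mxE ji mul0r.
Qed.

Lemma dot_mulmxr M x y : dot x (M *m y) = dot (M^T *m x) y.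
Proof.
rewrite /dot; under eq_bigr do rewrite mxE mulr_sumr.
rewrite exchange_big; apply: eq_bigr => j _; rewrite mxE mulr_suml.
by apply: eq_bigr => i _; rewrite mxE mulrCA mulrA.
Qed.

Lemma trmx_mul_dot x y : x^T *m y = (dot x y)%:M.
Proof.
by rewrite [LHS]mx11_scalar mxE; congr _%:M; apply: eq_bigr => i _; rewrite mxE.
Qed.

End DotProduct.

Lemma dot_map (T T' : comNzRingType) (f : {rmorphism T -> T'}) (n : nat)
    (x y : 'cV[T]_n) :
  dot (map_mx f x) (map_mx f y) = f (dot x y).
Proof. by rewrite rmorph_sum; apply: eq_bigr => i _; rewrite !mxE rmorphM. Qed.

Definition nonneg {F : numDomainType} {n : nat} (x : 'cV[F]_n) :=
  forall i, 0 <= x i 0.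

Lemma dot_ge0 (F : numDomainType) (n : nat) (x y : 'cV[F]_n) :
  nonneg x -> nonneg y -> 0 <= dot x y.
Proof. by move=> x0 y0; apply: sumr_ge0 => i _; apply: mulr_ge0. Qed.

Definition supported {T : nmodType} {n : nat} (H : {set 'I_n}) (x : 'cV[T]_n) :=
  forall j, j \notin H -> x j 0 = 0.

Lemma supported_sub (T : nmodType) (n : nat) (H H' : {set 'I_n})
    (x : 'cV[T]_n) :
  H \subset H' -> supported H x -> supported H' x.
Proof.
move=> HH' xH j jH'; apply: xH; apply: contraNN jH'.
exact: (fintype.subsetP HH').
Qed.

Lemma supportedB (T : zmodType) (n : nat) (H : {set 'I_n}) (x y : 'cV[T]_n) :
  supported H x -> supported H y -> supported H (x - y).
Proof. by move=> xH yH j jH; rewrite !mxE xH // yH // subrr. Qed.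

Lemma supportedN (T : zmodType) (n : nat) (H : {set 'I_n}) (x : 'cV[T]_n) :
  supported H x -> supported H (- x).
Proof. by move=> xH j jH; rewrite mxE xH // oppr0. Qed.

Lemma supported_set1 (T : pzRingType) (n : nat) i (x : 'cV[T]_n) :
  supported [set i]%SET x -> x = x i 0 *: delta_mx i 0.
Proof.
move=> xi; apply/colP => j; rewrite !mxE andbT.
by have [->|ji] := eqVneq j i; rewrite ?mulr1 ?mulr0 // xi // inE.
Qed.

Section CoordinateRestriction.
Variables (T : nmodType) (n : nat).
Implicit Types (H : {set 'I_n}) (x : 'cV[T]_n).

Definition coord_restrict H x : 'cV[T]_n :=
  \col_j if j \in H then x j 0 else 0.

Lemma coord_restrict_supported H x : supported H (coord_restrict H x).
Proof. by move=> j jH; rewrite mxE (negPf jH). Qed.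

Lemma coord_restrictDC H x : coord_restrict H x + coord_restrict (~: H) x = x.
Proof.
by apply/colP => j; rewrite !mxE inE; case: (j \in H); rewrite ?addr0 ?add0r.
Qed.

End CoordinateRestriction.

Definition Z_matrix {F : numDomainType} {n : nat} (M : 'M[F]_n) :=
  forall i j, i != j -> M i j <= 0.

Lemma Z_matrix_mulmx_le0 (F : numDomainType) (n : nat) (M : 'M[F]_n)
    (x : 'cV[F]_n) i :
  Z_matrix M -> nonneg x -> x i 0 = 0 -> (M *m x) i 0 <= 0.
Proof.
move=> ZM x0 xi0; rewrite mxE; apply: sumr_le0 => j _.
have [<-|ij] := eqVneq i j; first by rewrite xi0 mulr0.
by rewrite mulr_le0_ge0 ?ZM.
Qed.

Lemma Z_matrix_dot_le0 (F : numDomainType) (n : nat) (M : 'M[F]_n)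
    (x y : 'cV[F]_n) (H : {set 'I_n}) :
  Z_matrix M -> nonneg x -> nonneg y ->
  supported H x -> supported (~: H) y -> dot x (M *m y) <= 0.
Proof.
move=> ZM x0 y0 xH yH; apply: sumr_le0 => i _.
have [iH|/xH ->] := boolP (i \in H); last by rewrite mul0r.
by rewrite mulr_ge0_le0 ?Z_matrix_mulmx_le0 // yH ?inE ?iH.
Qed.

(** * Affine forms *)

Section SymmetricForm.
Variables (F : realFieldType) (n : nat) (S : 'M[F]_n).
Hypothesis symS : S^T = S.
Implicit Types x y : 'cV[F]_n.

Lemma form_dotC x y : dot x (S *m y) = dot y (S *m x).
Proof. by rewrite dot_mulmxr symS dotC. Qed.

Lemma form_shift t x y : dot (x + t *: y) (S *m (x + t *: y)) =
  dot x (S *m x) + 2 * t * dot y (S *m x) + t ^+ 2 * dot y (S *m y).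
Proof.
rewrite mulmxDr -scalemxAr linearD linearZ /= !dotDl !dotZl (form_dotC x y).
by ring.
Qed.

Lemma psd_form_isotropic x :
  (forall y, 0 <= dot y (S *m y)) -> dot x (S *m x) = 0 -> S *m x = 0.
Proof.
move=> psdS x0; apply/colP => i; rewrite [RHS]mxE -dot_deltal.
set b := dot _ _; set D := dot (delta_mx i 0) (S *m delta_mx i 0).
have D0 : 0 <= D by exact: psdS.
have := psdS (x + (- b / (D + 1)) *: delta_mx i 0).
rewrite form_shift x0 -/b -/D add0r.
have -> : 2 * (- b / (D + 1)) * b + (- b / (D + 1)) ^+ 2 * D =
          - (b ^+ 2 * ((D + 2) / (D + 1) ^+ 2)).
  by field; rewrite gt_eqF //; lra.
rewrite oppr_ge0 pmulr_lle0; last by rewrite divr_gt0 ?exprn_gt0 //; lra.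
by move=> b0; apply/eqP; rewrite -sqrf_eq0 eq_le b0 sqr_ge0.
Qed.

End SymmetricForm.

Record affine_form {F : realFieldType} {n : nat} (S : 'M[F]_n) (a : 'cV[F]_n)
    : Prop := AffineForm {
  form_sym : S^T = S;
  form_Z_matrix : Z_matrix S;
  form_connected : forall J : {set 'I_n},
    (exists i, i \in J) -> (exists j, j \notin J) ->
    exists i j, [/\ i \in J, j \notin J & S i j != 0];
  form_null_gt0 : forall i, 0 < a i 0;
  form_null : S *m a = 0 }.

Section AffineForm.
Variables (F : realFieldType) (n : nat) (S : 'M[F]_n) (a : 'cV[F]_n).
Hypothesis affS : affine_form S a.
Implicit Types (H : {set 'I_n}) (u v x y c p q : 'cV[F]_n).

Let symS := form_sym affS.

Lemma dot_null x : dot a (S *m x) = 0.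
Proof. by rewrite (form_dotC symS) (form_null affS) linear0. Qed.

Lemma form_sum_squares x : 2 * dot x (S *m x) =
  - \sum_i \sum_j S i j * a i 0 * a j 0 * (x i 0 / a i 0 - x j 0 / a j 0) ^+ 2.
Proof.
pose y i := x i 0 / a i 0.
have xE i : x i 0 = a i 0 * y i.
  by rewrite mulrC divfK // gt_eqF // (form_null_gt0 affS).
have left_squares : \sum_i \sum_j S i j * a i 0 * a j 0 * y i ^+ 2 = 0.
  rewrite big1 // => i _; transitivity (a i 0 * y i ^+ 2 * (S *m a) i 0).
    by rewrite mxE mulr_sumr; apply: eq_bigr => j _; ring.
  by rewrite (form_null affS) mxE mulr0.
have right_squares : \sum_i \sum_j S i j * a i 0 * a j 0 * y j ^+ 2 = 0.
  rewrite exchange_big -[RHS]left_squares; apply: eq_bigr => i _.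
  by apply: eq_bigr => j _; rewrite -[in S j i]symS mxE; ring.
transitivity (2 * dot x (S *m x) -
    \sum_i \sum_j S i j * a i 0 * a j 0 * y i ^+ 2 -
    \sum_i \sum_j S i j * a i 0 * a j 0 * y j ^+ 2).
  by rewrite left_squares right_squares !subr0.
rewrite /dot mulr_sumr -!sumrN -!big_split; apply: eq_bigr => i _ /=.
rewrite mxE !mulr_sumr -!sumrN -!big_split; apply: eq_bigr => j _ /=.
by rewrite -/(y i) -/(y j) !xE; ring.
Qed.

Lemma form_ge0 x : 0 <= dot x (S *m x).
Proof.
have a0 := form_null_gt0 affS; suff : 0 <= 2 * dot x (S *m x) by lra.
rewrite form_sum_squares oppr_ge0.
apply: sumr_le0 => i _; apply: sumr_le0 => j _.
have [->|ij] := eqVneq i j; first by rewrite subrr expr0n mulr0.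
rewrite mulr_le0_ge0 ?sqr_ge0 // !(mulr_le0_ge0 _ (ltW _)) //.
exact: form_Z_matrix affS _ _ ij.
Qed.

Lemma form_isotropic x : dot x (S *m x) = 0 -> S *m x = 0.
Proof. exact/(psd_form_isotropic symS)/form_ge0. Qed.

(* Subtracting from u its smallest multiple s a of the null vector, the set
   where u = s a would disconnect S. *)
Lemma form_monotone H u :
  H \proper 'I_n -> supported H u -> (forall j, j \in H -> 0 <= (S *m u) j 0) ->
  nonneg u.
Proof.
move=> /properTP[k0 k0H] uH Su0 j; rewrite leNgt; apply/negP => uj.
have a0 := form_null_gt0 affS.
have [j0 _ j0_min] := @arg_minP _ _ _ j xpredT (fun k => u k 0 / a k 0) isT.
set s := u j0 0 / a j0 0 in j0_min.
have s0 : s < 0.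
  by apply: le_lt_trans (j0_min j isT) _; rewrite pmulr_llt0 ?invr_gt0.
pose w := u - s *: a.
have wE k : w k 0 = u k 0 - s * a k 0 by rewrite !mxE.
have w0 k : 0 <= w k 0 by rewrite wE subr_ge0 -ler_pdivlMr // j0_min.
have Sw : S *m w = S *m u.
  by rewrite mulmxBr -scalemxAr (form_null affS) scaler0 subr0.
have w_pos k : k \notin H -> 0 < w k 0.
  by move=> /uH uk; rewrite wE uk sub0r oppr_gt0 pmulr_llt0.
have [||i [k [wi wk Sik]]] :=
  form_connected affS (J := [set k | w k 0 == 0]%SET).
- by exists j0; rewrite inE wE /s divfK ?subrr // gt_eqF.
- by exists k0; rewrite inE gt_eqF ?w_pos.
move: wi wk; rewrite !inE => /eqP wi wk.
have iH : i \in H by apply/negPn/negP => /w_pos; rewrite wi ltxx.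
have ik : i != k by apply: contraNneq wk => <-; rewrite wi.
have := Su0 i iH; rewrite -Sw leNgt => /negP; apply.
rewrite mxE (bigD1 k) //= -[ltRHS]addr0 ltr_leD //.
  by rewrite nmulr_rlt0 lt_neqAle ?Sik ?(form_Z_matrix affS) // eq_sym wk w0.
apply: sumr_le0 => m _; have [<-|im] := eqVneq i m; first by rewrite wi mulr0.
by rewrite mulr_le0_ge0 ?(form_Z_matrix affS).
Qed.

Definition basic_solution p H c :=
  supported H c /\ forall j, j \in H -> (S *m c) j 0 = p j 0.

Lemma form_injective H u :
  H \proper 'I_n -> basic_solution 0 H u -> u = 0.
Proof.
move=> pH [uH Su]; apply/colP => j; apply/eqP.
rewrite mxE eq_le -oppr_ge0 andbC.
rewrite (form_monotone pH uH) => [/=|k kH]; last by rewrite Su // mxE.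
have := form_monotone pH (supportedN uH) _ j; rewrite mxE; apply=> k kH.
by rewrite mulmxN mxE Su // mxE oppr0.
Qed.

Lemma basic_solution_unique p H c c' :
  H \proper 'I_n -> basic_solution p H c -> basic_solution p H c' -> c = c'.
Proof.
move=> pH [cH Sc] [c'H Sc']; apply/eqP; rewrite -subr_eq0; apply/eqP.
apply: (form_injective pH); split=> [|j jH]; first exact: supportedB.
by rewrite mulmxBr [LHS]mxE [X in _ + X]mxE Sc // Sc' // subrr mxE.
Qed.

Lemma basic_solution_exists p H :
  H \proper 'I_n -> exists c, basic_solution p H c.
Proof.
move=> pH; pose B : 'M[F]_n :=
  \matrix_(i, j) if i \in H then S i j else (i == j)%:R.
have BE x i : (B *m x) i 0 = if i \in H then (S *m x) i 0 else x i 0.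
  rewrite [LHS]mxE; under eq_bigr do rewrite mxE.
  case: ifP => _; first by rewrite mxE.
  rewrite (bigD1 i) //= eqxx mul1r big1 ?addr0 // => j.
  by rewrite eq_sym => /negPf ->; rewrite mul0r.
have uB : B \in unitmx.
  rewrite unitmxE unitfE -det_tr; apply/det0P => -[v /negP v0 vB].
  have Bv : B *m v^T = 0 by apply: trmx_inj; rewrite trmx_mul trmxK trmx0.
  apply: v0; rewrite -trmx_eq0; apply/eqP/(form_injective pH).
  by split=> j jH; have := BE v^T j; rewrite Bv ?jH ?(negPf jH) mxE => <-.
exists (invmx B *m \col_j if j \in H then p j 0 else 0).
split=> j jH; have := BE (invmx B *m \col_j if j \in H then p j 0 else 0) j.
  by rewrite mulKVmx // (negPf jH) mxE (negPf jH).
by rewrite mulKVmx // jH mxE jH.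
Qed.

Lemma form_kernel x : S *m x = 0 -> exists s, x = s *: a.
Proof.
case: (posnP n) => [n0|n0] Sx.
  by exists 0; apply/colP => i; have := ltn_ord i; rewrite {2}n0.
pose o := Ordinal n0; exists (x o 0 / a o 0).
apply/eqP; rewrite -subr_eq0; apply/eqP/(form_injective (proper_setC1 o)).
split=> j jo; last first.
  by rewrite mulmxBr -scalemxAr Sx (form_null affS) scaler0 subr0.
move: jo; rewrite !inE negbK => /eqP ->.
by rewrite !mxE divfK ?subrr // gt_eqF ?(form_null_gt0 affS).
Qed.

Lemma form_range q : dot a q = 0 -> exists u, S *m u = q.
Proof.
case: (posnP n) => [n0|n0] aq.
  by exists 0; apply/colP => i; have := ltn_ord i; rewrite {2}n0.
pose o := Ordinal n0.
have [u [_ Su]] := basic_solution_exists q (proper_setC1 o).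
have ao : a o 0 != 0 by rewrite gt_eqF ?(form_null_gt0 affS).
have Suq j : j != o -> (S *m u - q) j 0 = 0.
  by move=> jo; rewrite mxE Su ?mxE ?subrr // !inE.
exists u; apply/eqP; rewrite -subr_eq0; apply/eqP/colP => j; rewrite [RHS]mxE.
have [->|/Suq//] := eqVneq j o; apply: (mulfI ao); rewrite mulr0.
have : dot a (S *m u - q) = 0 by rewrite linearB /= dot_null aq subrr.
by rewrite /dot (bigD1 o) //= big1 ?addr0 // => i /Suq ->; rewrite mulr0.
Qed.

Lemma basic_solution_ge0 p H c :
  H \proper 'I_n -> basic_solution p H c -> nonneg p ->
  nonneg c.
Proof.
by move=> pH [cH Sc] p0; apply: (form_monotone pH) => // j jH; rewrite Sc.
Qed.

Lemma supported_coord_le_form H k : H \proper 'I_n ->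
  exists B, forall x, supported H x -> `|x k 0| <= dot x (S *m x) + B.
Proof.
move=> pH; have [h [hH Sh]] := basic_solution_exists (delta_mx k 0) pH.
exists (dot h (S *m h)) => x xH.
have [kH|kH] := boolP (k \in H); last first.
  by rewrite xH // normr0 addr_ge0 ?form_ge0.
have hx : dot h (S *m x) = x k 0.
  rewrite (form_dotC symS) dotC -dot_deltal; apply: eq_bigr => j _.
  by have [jH|jH] := boolP (j \in H); [rewrite Sh|rewrite xH ?mulr0].
have := form_ge0 (x + 1 *: h); have := form_ge0 (x + (-1) *: h).
have := form_ge0 x; have := form_ge0 h; rewrite !(form_shift symS) hx.
by rewrite ler_norml => *; apply/andP; split; lra.
Qed.

Definition feasible_support q H v :=
  [/\ H \proper 'I_n, basic_solution (- q) H v & nonneg v].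

(* Pairing with the null vector keeps the enlarged support proper. *)
Lemma feasible_support_grow q H v j0 :
  0 <= dot q a -> feasible_support q H v -> (q + S *m v) j0 0 < 0 ->
  exists H' v', feasible_support q H' v' /\ H \proper H'.
Proof.
move=> qa [pH [vH Sv] v0]; set y := q + S *m v => y_neg.
have yH j : j \in H -> y j 0 = 0 by move=> jH; rewrite /y mxE Sv // mxE subrr.
pose H' := H :|: [set j | y j 0 < 0]%SET.
have y_le0 j : j \in H' -> y j 0 <= 0.
  by rewrite !inE => /orP[/yH->//|/ltW].
have pH' : H' \proper 'I_n.
  apply/properTP/existsP; rewrite -negb_forall; apply/negP => /forallP full.
  have : 0 <= dot a y by rewrite linearD /= dot_null addr0 dotC.
  rewrite leNgt => /negP; apply; rewrite /dot (bigD1 j0) //= -[ltRHS]addr0.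
  rewrite ltr_leD ?pmulr_rlt0 ?(form_null_gt0 affS) //.
  by apply: sumr_le0 => j _; rewrite pmulr_rle0 ?(form_null_gt0 affS) ?y_le0.
have [u [uH' Su]] := basic_solution_exists (- q) pH'.
have vH' : supported H' v by apply: supported_sub vH; apply: finset.subsetUl.
exists H', u; split; last first.
  rewrite properE finset.subsetUl /=; apply/subsetPn; exists j0.
    by rewrite !inE y_neg orbT.
  by apply: contraL y_neg => /yH ->; rewrite ltxx.
split=> // j; rewrite -[u](subrK v) mxE addr_ge0 //.
apply: (form_monotone pH') => [|k kH']; first exact: supportedB.
rewrite mulmxBr mxE Su // mxE [X in _ + X]mxE -opprD oppr_ge0.
by have := y_le0 k kH'; rewrite /y mxE.
Qed.

Lemma linear_complementarity q : (0 < n)%N -> 0 <= dot q a ->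
  exists H v, feasible_support q H v /\ nonneg (q + S *m v).
Proof.
move=> n0 qa.
pose feasible H := `[< exists v, feasible_support q H v >].
have [|H /maxsetP[/asboolP[v vP] Hmax]] := @ex_maxset _ feasible.
  exists finset.set0; apply/asboolP; exists 0.
  split=> [||j]; last by rewrite mxE.
    by apply/properTP; exists (Ordinal n0); rewrite inE.
  by split=> j; rewrite ?mxE ?inE.
exists H, v; split=> // j; rewrite leNgt; apply/negP => y_neg.
have [H' [v' [v'P HH']]] := feasible_support_grow qa vP y_neg.
have feasH' : feasible H' by apply/asboolP; exists v'.
by have := HH'; rewrite (Hmax H' feasH' (proper_sub HH')) fintype.properxx.
Qed.

Definition cut_orthant p : set 'cV[F]_n :=
  [set c : 'cV[F]_n | nonneg c /\ forall j, (S *m c) j 0 <= p j 0].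

Lemma basic_solution_cut_orthant p H c : nonneg p ->
  H \proper 'I_n -> basic_solution p H c -> cut_orthant p c.
Proof.
move=> p0 pH cP; have c0 := basic_solution_ge0 pH cP p0; split=> // j.
have [jH|jH] := boolP (j \in H); first by rewrite cP.2.
apply: le_trans (p0 j); apply: Z_matrix_mulmx_le0 c0 (cP.1 j jH).
exact: form_Z_matrix affS.
Qed.

(* A solution v of the complementarity problem for q writes q as the
   nonnegative combination (q + S v) - S v of the functionals defining the
   cut orthant, using only those that are tight at c. *)
Lemma basic_solution_minimizes p q H v c c' :
  feasible_support q H v -> nonneg (q + S *m v) ->
  basic_solution p H c -> cut_orthant p c' -> dot q c <= dot q c'.
Proof.
move=> [_ [vH Sv] v0] y0 [cH Sc] [c'0 Sc'].
have qE x : dot q x = dot (q + S *m v) x - dot v (S *m x).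
  by rewrite dotDl [dot (S *m v) x]dotC (form_dotC symS v) addrK.
rewrite !qE lerB //.
  rewrite [leLHS]big1 => [|j _]; first exact: dot_ge0.
  have [jH|jH] := boolP (j \in H); last by rewrite cH ?mulr0.
  by rewrite mxE Sv // mxE subrr mul0r.
apply: ler_sum => j _.
have [jH|jH] := boolP (j \in H); last by rewrite vH ?mul0r.
by rewrite Sc // ler_wpM2l.
Qed.

(* The functional is the sum of the slacks c_j, j outside H, and p_j - (S c)_j,
   j in H, up to a constant. *)
Lemma basic_solution_exposed p H c : H \proper 'I_n -> basic_solution p H c ->
  exists q, forall c', cut_orthant p c' ->
    dot q c <= dot q c' /\ (dot q c' = dot q c -> c' = c).
Proof.
move=> pH cP; pose slack x j := if j \in H then p j 0 - (S *m x) j 0 else x j 0.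
pose indic (J : {set 'I_n}) : 'cV[F]_n := \col_j (j \in J)%:R.
have dot_indic J x : dot (indic J) x = \sum_(j in J) x j 0.
  rewrite /dot [RHS]big_mkcond; apply: eq_bigr => j _; rewrite mxE.
  by case: (j \in J); rewrite ?mul1r ?mul0r.
pose q := indic (~: H) - S *m indic H.
have slackE x : \sum_j slack x j = dot q x + dot (indic H) p.
  rewrite dotBl [dot (S *m _) x]dotC (form_dotC symS) !dot_indic.
  rewrite (bigID [in H]) /= addrC -addrA; congr (_ + _).
    by apply: eq_big => [j|j /negPf jH]; rewrite ?inE // /slack jH.
  by rewrite addrC -sumrB; apply: eq_bigr => j jH; rewrite /slack jH.
have slack_ge0 x j : cut_orthant p x -> 0 <= slack x j.
  by move=> [x0 Sx]; rewrite /slack; case: ifP; rewrite ?subr_ge0.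
have slackc j : slack c j = 0.
  by rewrite /slack; case: ifPn => jH; rewrite ?cP.2 ?subrr ?cP.1.
exists q => x xP; have := slackE c; rewrite big1 // => /esym/eqP.
rewrite addr_eq0 => /eqP ->; split.
  by rewrite -subr_ge0 opprK -slackE sumr_ge0 // => j _; apply: slack_ge0.
move/eqP; rewrite -subr_eq0 opprK -slackE.
rewrite psumr_eq0 => [/allP slackx|j _]; last exact: slack_ge0.
apply: (basic_solution_unique pH _ cP); split=> j jH;
  have /eqP := slackx j (mem_index_enum j); rewrite /slack ?jH ?(negPf jH) //=.
by move/eqP; rewrite subr_eq0 => /eqP.
Qed.

End AffineForm.

(** * Roots of affine Cartan matrices *)

Local Notation ratmx := (map_mx (intr : int -> rat)).

Lemma map_ratr_intmx (C : numFieldType) (m n : nat) (M : 'M[int]_(m, n)) :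
  map_mx (ratr : rat -> C) (ratmx M) = map_mx intr M.
Proof. by apply/matrixP => i j; rewrite !mxE ratr_int. Qed.

Section SimpleReflection.
Variables (T : comNzRingType) (n : nat) (A : 'M[T]_n).
Implicit Types x y : 'cV[T]_n.

Definition simple_reflection i x : 'cV[T]_n :=
  x - (A *m x) i 0 *: delta_mx i 0.

Lemma simple_reflection_is_linear i : linear (simple_reflection i).
Proof.
move=> t x y; rewrite /simple_reflection mulmxDr -scalemxAr !mxE.
by rewrite scalerDl scalerBr scalerA opprD addrACA.
Qed.

HB.instance Definition _ i := GRing.isLinear.Build T 'cV[T]_n 'cV[T]_n *:%R
  (simple_reflection i) (simple_reflection_is_linear i).

Lemma mulmx_simple_reflection i x :
  A *m simple_reflection i x = A *m x - (A *m x) i 0 *: col i A.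
Proof. by rewrite mulmxBr -scalemxAr -colE. Qed.

Lemma dot_col x i : dot x (col i A) = (A^T *m x) i 0.
Proof. by rewrite colE dot_mulmxr dotC dot_deltal. Qed.

Lemma mulmx_simple_reflection_diag i x :
  A i i = 2 -> (A *m simple_reflection i x) i 0 = - (A *m x) i 0.
Proof.
move=> Aii; rewrite mulmx_simple_reflection.
by move: (A *m x) => y; rewrite !mxE Aii; ring.
Qed.

End SimpleReflection.

Lemma map_simple_reflection (T T' : comNzRingType) (f : {rmorphism T -> T'})
    (n : nat) (A : 'M[T]_n) i (x : 'cV[T]_n) :
  map_mx f (simple_reflection A i x) =
  simple_reflection (map_mx f A) i (map_mx f x).
Proof.
rewrite /simple_reflection map_mxB map_mxZ map_delta_mx -map_mxM.
by rewrite [map_mx f (A *m x) i 0]mxE.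
Qed.

Lemma dot_simple_reflectionl (T : comNzRingType) (n : nat) (A : 'M[T]_n) i
    (x p : 'cV[T]_n) :
  dot (simple_reflection A^T i x) p = dot x (p - p i 0 *: col i A).
Proof. by rewrite dotBl dotZl dot_deltal linearB linearZ /= dot_col mulrC. Qed.

Lemma dot_simple_reflection (T : comNzRingType) (n : nat) (A : 'M[T]_n) i
    (x y : 'cV[T]_n) : A i i = 2 ->
  dot (simple_reflection A^T i y) (A *m simple_reflection A i x) =
  dot y (A *m x).
Proof.
move=> Aii; rewrite dot_simple_reflectionl mulmx_simple_reflection_diag //.
by rewrite mulmx_simple_reflection scaleNr opprK subrK.
Qed.

Section Displacement.
Variables (T : comNzRingType) (n : nat).
Implicit Types (A : 'M[T]_n) (m x : 'cV[T]_n) (H : {set 'I_n}) (js : seq 'I_n).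

(* If lambda pairs to m with the simple coroots and w is the product of the
   reflections in js, then lambda - w(lambda) has coordinates displacement A js
   *m m on the simple roots. *)
Definition displacement A js : 'M[T]_n :=
  foldr (fun j D => D + delta_mx j j *m (1%:M - A *m D)) 0 js.

Definition displaced_labels A m js : 'cV[T]_n :=
  m - A *m (displacement A js *m m).

Lemma displacement_cons A m j js : displacement A (j :: js) *m m =
  displacement A js *m m + displaced_labels A m js j 0 *: delta_mx j 0.
Proof.
rewrite /= mulmxDl -mulmxA mulmxBl mul1mx -mulmxA -(mul_delta_mx (0 : 'I_1)).
by rewrite -mulmxA -rowE [row j _]mx11_scalar mul_mx_scalar mxE.
Qed.

Lemma displaced_labels_cons A m j js : displaced_labels A m (j :: js) =
  displaced_labels A m js - displaced_labels A m js j 0 *: col j A.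
Proof.
rewrite {1}/displaced_labels displacement_cons mulmxDr -scalemxAr -colE.
by rewrite opprD addrA.
Qed.

Lemma displacement_supported A m H js :
  all (fun j => j \in H) js -> supported H (displacement A js *m m).
Proof.
elim: js => [_|j js IH /andP[jH jsH]] k kH; first by rewrite mul0mx mxE.
have kj : k == j = false by apply: contraNF kH => /eqP ->.
by rewrite displacement_cons mxE IH // !mxE andbT kj mulr0 addr0.
Qed.

Lemma displacement_reflections A m H js x :
  all (fun j => j \in H) js -> (forall j, j \in H -> (A *m x) j 0 = m j 0) ->
  x - displacement A js *m m = foldr (simple_reflection A) x js.
Proof.
move=> + Ax; elim: js => [_|j js IH /andP[jH jsH]].
  by rewrite mul0mx subr0.
rewrite displacement_cons /= -IH // /simple_reflection mulmxBr opprD addrA.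
by congr (_ - _ *: _); rewrite [LHS]mxE [RHS]mxE Ax.
Qed.

End Displacement.

Lemma map_displacement (T T' : comNzRingType) (f : {rmorphism T -> T'})
    (n : nat) (A : 'M[T]_n) js :
  map_mx f (displacement A js) = displacement (map_mx f A) js.
Proof.
elim: js => [|j js IH]; first by rewrite map_mx0.
by rewrite map_mxD map_mxM map_mxB map_mx1 map_mxM map_delta_mx IH.
Qed.

Lemma diag_mx_mulE (T : pzSemiRingType) (n : nat) (e : 'rV[T]_n)
    (x : 'cV[T]_n) i :
  (diag_mx e *m x) i 0 = e 0 i * x i 0.
Proof. by rewrite mul_diag_mx mxE. Qed.

Lemma diag_mx_mul_delta (T : comNzRingType) (n : nat) (e : 'rV[T]_n) i :
  diag_mx e *m delta_mx i 0 = e 0 i *: (delta_mx i 0 : 'cV_n).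
Proof.
apply/colP => j; rewrite diag_mx_mulE !mxE.
by have [->//|_] := eqVneq j i; rewrite !mulr0.
Qed.

Lemma root_coroot_reflection (n : nat) (A : 'M[int]_n) i b bv :
  root_coroot A b bv ->
  root_coroot A (simple_reflection A i b) (simple_reflection A^T i bv).
Proof. exact: RootReflect. Qed.

Definition symmetrizer {n : nat} (A : 'M[int]_n) (e : 'rV[rat]_n) :=
  (forall i, 0 < e 0 i) /\
  diag_mx e *m ratmx A = (ratmx A)^T *m diag_mx e.

Lemma symmetrizerP (n : nat) (A : 'M[int]_n) (e : 'rV[rat]_n) :
  symmetrizer A e <-> (forall i, 0 < e 0 i) /\
    forall i j, e 0 i * (A i j)%:~R = e 0 j * (A j i)%:~R.
Proof.
split=> -[e0 eA]; split=> //.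
  move=> i j; have /matrixP/(_ i j) := eA.
  by rewrite mul_diag_mx mul_mx_diag !mxE [RHS]mulrC.
by apply/matrixP => i j; rewrite mul_diag_mx mul_mx_diag !mxE [RHS]mulrC.
Qed.

Lemma symmetrizer_eq0 (n : nat) (A : 'M[int]_n) (e : 'rV[rat]_n) i j :
  symmetrizer A e -> A i j = 0 -> A j i = 0.
Proof.
move=> /symmetrizerP[e0 eA] Aij; apply: (@intr_inj rat).
by apply: (mulfI (lt0r_neq0 (e0 j))); rewrite -eA Aij !mulr0.
Qed.

Definition symmetrized {n : nat} (A : 'M[int]_n) (e : 'rV[rat]_n) : 'M[rat]_n :=
  diag_mx e *m ratmx A.

Lemma symmetrized_mulE (n : nat) (A : 'M[int]_n) (e : 'rV[rat]_n) x i :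
  (symmetrized A e *m x : 'cV_n) i 0 = e 0 i * (ratmx A *m x) i 0.
Proof. by rewrite -mulmxA diag_mx_mulE. Qed.

Lemma symmetric_sum_even (I : Type) (r : seq I) (G : I -> I -> int) :
  (forall i j, G i j = G j i) -> (forall i, (2 %| G i i)%Z) ->
  (2 %| \sum_(i <- r) \sum_(j <- r) G i j)%Z.
Proof.
move=> Gsym Gdiag; elim: r => [|x r IH]; first by rewrite big_nil.
rewrite big_cons; under [X in _ + X]eq_bigr do rewrite big_cons.
rewrite big_split /= big_cons; under [X in _ + (X + _)]eq_bigr do rewrite Gsym.
rewrite addrA -[G x x + _ + _]addrA.
apply: rpredD IH; apply: rpredD (Gdiag x) _.
by rewrite -mulr2n -[_ *+ 2]mulr_natl; exact: dvdz_mulr.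
Qed.

Section SymmetrizableRoots.
Variables (n : nat) (A : 'M[int]_n) (e : 'rV[rat]_n).
Hypothesis gcmA : generalized_cartan_matrix A.
Hypothesis symA : symmetrizer A e.
Implicit Types (b bv x y : 'cV[int]_n) (P : {set 'I_n}).
Let S := symmetrized A e.

Lemma cartan_diag i : A i i = 2.
Proof. by case: gcmA. Qed.

Lemma cartan_Z_matrix : Z_matrix A.
Proof. by case: gcmA. Qed.

Lemma symmetrized_tr : S^T = S.
Proof. by rewrite trmx_mul tr_diag_mx -symA.2. Qed.

Lemma symmetrized_Z_matrix : Z_matrix S.
Proof.
move=> i j ij; rewrite /S /symmetrized mul_diag_mx !mxE pmulr_rle0 ?symA.1 //.
by rewrite lerz0 cartan_Z_matrix.
Qed.

Lemma simple_reflection_symmetrizer i (x : 'cV[rat]_n) :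
  diag_mx e *m simple_reflection (ratmx A) i x =
  simple_reflection (ratmx A)^T i (diag_mx e *m x).
Proof.
rewrite /simple_reflection mulmxA -symA.2 symmetrized_mulE mulmxBr -scalemxAr.
by rewrite diag_mx_mul_delta scalerA [in RHS]mulrC.
Qed.

Lemma symmetrized_simple_reflection i (x : 'cV[rat]_n) :
  dot (simple_reflection (ratmx A) i x) (S *m simple_reflection (ratmx A) i x) =
  dot x (S *m x).
Proof.
have SE z : dot z (S *m z) = dot (diag_mx e *m z) (ratmx A *m z).
  by rewrite /S -mulmxA dot_mulmxr tr_diag_mx.
rewrite !SE simple_reflection_symmetrizer dot_simple_reflection //.
by rewrite mxE cartan_diag.
Qed.

(* Roots x and their coroots y = 2 x / (x|x) have this shape, and so do their
   restrictions to a set of indices. *)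
Definition coproportional x y :=
  exists2 t : rat, 0 < t & t *: ratmx y = diag_mx e *m ratmx x.

Lemma coproportional_coord x y : coproportional x y ->
  exists2 t : rat, 0 < t & forall i, t * (y i 0)%:~R = e 0 i * (x i 0)%:~R.
Proof.
move=> [t t0 tE]; exists t => // i; have /colP/(_ i) := tE.
by rewrite diag_mx_mulE !mxE.
Qed.

Lemma coproportional_sgz x y i :
  coproportional x y -> sgz (y i 0) = sgz (x i 0).
Proof.
move=> /coproportional_coord[t t0 /(_ i) tE]; have := congr1 (@sgz rat) tE.
by rewrite !sgzM (gtr0_sgz t0) (gtr0_sgz (symA.1 i)) !mul1r !sgz_int.
Qed.

Lemma coproportional_ge0 x y i :
  coproportional x y -> (0 <= y i 0) = (0 <= x i 0).
Proof. by move=> /coproportional_sgz xy; rewrite -[LHS]sgz_ge0 xy sgz_ge0. Qed.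

Lemma coproportional_le0 x y i :
  coproportional x y -> (y i 0 <= 0) = (x i 0 <= 0).
Proof. by move=> /coproportional_sgz xy; rewrite -[LHS]sgz_le0 xy sgz_le0. Qed.

Lemma root_coproportional b bv : root_coroot A b bv -> coproportional b bv.
Proof.
elim=> {b bv} [i|i b bv _ [t t0 tE]].
  exists (e 0 i); first exact: symA.1.
  by rewrite map_delta_mx diag_mx_mul_delta.
exists t => //.
rewrite -/(simple_reflection A^T i bv) -/(simple_reflection A i b).
rewrite !map_simple_reflection -linearZ /= -map_trmx tE.
by rewrite simple_reflection_symmetrizer.
Qed.

Lemma root_pairing b bv : root_coroot A b bv -> dot bv (A *m b) = 2.
Proof.
elim=> {b bv} [i|i b bv _ IH].
  by rewrite dot_deltal -colE mxE cartan_diag.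
by rewrite -[RHS]IH; apply/dot_simple_reflection/cartan_diag.
Qed.

Lemma coproportional_dot x y : coproportional x y -> exists2 t : rat, 0 < t &
  forall z, t * (dot y (A *m z))%:~R = dot (ratmx x) (S *m ratmx z).
Proof.
move=> [t t0 tE]; exists t => // z.
by rewrite -dot_map -dotZl tE map_mxM /S -mulmxA [RHS]dot_mulmxr tr_diag_mx.
Qed.

Lemma coproportional_even x y : coproportional x y -> (2 %| dot y (A *m x))%Z.
Proof.
move=> /coproportional_coord[t t0 tE]; have [_ eA] := (symmetrizerP A e).1 symA.
have -> : dot y (A *m x) = \sum_i \sum_j y i 0 * A i j * x j 0.
  apply: eq_bigr => i _; rewrite mxE mulr_sumr.
  by apply: eq_bigr => j _; rewrite mulrA.
apply: symmetric_sum_even => [i j|i]; last first.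
  by rewrite cartan_diag mulrAC [_ * 2]mulrC dvdz_mulr.
apply: (@intr_inj rat); apply: (mulfI (lt0r_neq0 t0)).
rewrite !intrM !mulrA !tE.
by rewrite [e 0 i * _ * _]mulrAC eA; ring.
Qed.

Lemma coproportional_restrict P x y :
  coproportional x y ->
  coproportional (coord_restrict P x) (coord_restrict P y).
Proof.
move=> /coproportional_coord[t t0 tE]; exists t => //; apply/colP => j.
by rewrite diag_mx_mulE !mxE; case: ifP; rewrite ?mulr0.
Qed.

End SymmetrizableRoots.

Record affine_cartan {n : nat} (A : 'M[int]_n) (a : 'cV[int]_n) (e : 'rV[rat]_n)
    : Prop := AffineCartan {
  affine_gcm : generalized_cartan_matrix A;
  affine_indecomposable : indecomposable_matrix A;
  affine_symmetrizer : symmetrizer A e;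
  marks_gt0 : forall i, 0 < a i 0;
  mul_marks : A *m a = 0 }.

Section AffineRoots.
Variables (n : nat) (A : 'M[int]_n) (a : 'cV[int]_n) (e : 'rV[rat]_n).
Hypothesis affA : affine_cartan A a e.
Implicit Types (b bv x y m : 'cV[int]_n) (H P : {set 'I_n}) (js : seq 'I_n).
Let S := symmetrized A e.
Let symA := affine_symmetrizer affA.
Let gcmA := affine_gcm affA.

Lemma affine_symmetrized : affine_form S (ratmx a).
Proof.
split=> [||J iJ jJ|i|].
- exact: symmetrized_tr symA.
- exact: symmetrized_Z_matrix gcmA symA.
- have [i [j [iJ' jJ' Aij]]] := (affine_indecomposable affA).2 J iJ jJ.
  exists i, j; split=> //; rewrite /S /symmetrized mul_diag_mx !mxE.
  by rewrite mulf_neq0 ?intr_eq0 // gt_eqF ?symA.1.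
- by rewrite mxE ltr0z (marks_gt0 affA).
- by rewrite /S -mulmxA -map_mxM (mul_marks affA) map_mx0 mulmx0.
Qed.

Lemma coproportional_norm_ge0 x y : coproportional e x y -> 0 <= dot y (A *m x).
Proof.
move=> /(coproportional_dot A)[t t0 tE].
rewrite -(@ler0z rat) -(pmulr_rge0 _ t0) tE.
exact: form_ge0 affine_symmetrized _.
Qed.

Lemma coproportional_norm_eq0 P x y : P \proper 'I_n -> supported P x ->
  coproportional e x y -> dot y (A *m x) = 0 -> x = 0.
Proof.
move=> pP xP /(coproportional_dot A)[t t0 tE] x0.
have Sx : S *m ratmx x = 0.
  by apply: (form_isotropic affine_symmetrized); rewrite -tE x0 mulr0.
suff /colP xQ : ratmx x = 0.
  by apply/colP => j; apply: (@intr_inj rat); have := xQ j; rewrite !mxE.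
apply: (form_injective affine_symmetrized pP); split=> j jP; last by rewrite Sx.
by rewrite mxE xP.
Qed.

Definition positive_support b : {set 'I_n} := [set i | 0 < b i 0]%SET.

Definition part_norm b bv P : int :=
  dot (coord_restrict P bv) (A *m coord_restrict P b).

Lemma part_norm_ge0 b bv P : coproportional e b bv -> 0 <= part_norm b bv P.
Proof. by move=> /(coproportional_restrict P)/coproportional_norm_ge0. Qed.

Lemma part_norm_even b bv P :
  coproportional e b bv -> (2 %| part_norm b bv P)%Z.
Proof.
by move=> /(coproportional_restrict P)/(coproportional_even gcmA symA).
Qed.

Lemma part_norm_eq0 b bv P : P \proper 'I_n -> coproportional e b bv ->
  part_norm b bv P = 0 -> coord_restrict P b = 0.
Proof.
move=> pP /(coproportional_restrict P)/(coproportional_norm_eq0 pP); apply.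
exact: coord_restrict_supported.
Qed.

(* The cross terms between the positive and the negative part of b are
   nonnegative. *)
Lemma part_norm_sum b bv : coproportional e b bv ->
  part_norm b bv (positive_support b) +
    part_norm b bv (~: positive_support b) <=
  dot bv (A *m b).
Proof.
move=> cob; set P := positive_support b.
set x := coord_restrict P b; set x' := coord_restrict (~: P) b.
set y := coord_restrict P bv; set y' := coord_restrict (~: P) bv.
have x0 i : 0 <= x i 0 by rewrite mxE inE; case: ifP => // /ltW.
have x'0 i : 0 <= (- x') i 0.
  by rewrite !mxE !inE oppr_ge0; case: ifPn => //; rewrite -leNgt.
have y0 i : 0 <= y i 0.
  rewrite mxE inE; case: ifP => // /ltW.
  by rewrite (coproportional_ge0 symA i cob).
have y'0 i : 0 <= (- y') i 0.
  rewrite !mxE !inE oppr_ge0; case: ifPn => //; rewrite -leNgt.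
  by rewrite (coproportional_le0 symA i cob).
have yx' : 0 <= dot y (A *m x').
  rewrite -oppr_le0 -linearN -mulmxN /=.
  apply: (Z_matrix_dot_le0 (cartan_Z_matrix gcmA) y0 x'0).
    exact: coord_restrict_supported.
  exact/supportedN/coord_restrict_supported.
have y'x : 0 <= dot y' (A *m x).
  rewrite -oppr_le0 dotC -linearN /= dotC.
  apply: (Z_matrix_dot_le0 (cartan_Z_matrix gcmA) y'0 x0).
    exact/supportedN/coord_restrict_supported.
  by rewrite finset.setCK; apply: coord_restrict_supported.
rewrite -[in leRHS](coord_restrictDC P bv) -[in leRHS](coord_restrictDC P b).
rewrite mulmxDr linearD /= !dotDl /part_norm -/x -/x' -/y -/y'.
lra.
Qed.

(* The norms of the positive and negative parts of b are nonnegative even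
   multiples of half the norm of b, and add up to at most the norm of b. *)
Lemma root_sign b bv : root_coroot A b bv ->
  nonneg b \/ (forall j, b j 0 <= 0).
Proof.
move=> rb; have cob := root_coproportional symA rb.
have := part_norm_sum cob; rewrite (root_pairing gcmA rb).
set P := positive_support b => norm_le2.
have normP0 := part_norm_ge0 P cob; have normP'0 := part_norm_ge0 (~: P) cob.
have /dvdzP[k normP] := part_norm_even P cob.
have /dvdzP[k' normP'] := part_norm_even (~: P) cob.
have [P0|P0] : part_norm b bv P = 0 \/ part_norm b bv (~: P) = 0 by lia.
- have [pP|] := boolP (P \proper 'I_n); last first.
    move/properTP=> full; left=> j; apply/ltW/negPn/negP => jP.
    by apply: full; exists j; rewrite inE.
  right=> j; rewrite -(coord_restrictDC P b) (part_norm_eq0 pP cob P0).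
  rewrite add0r mxE !inE.
  by case: ifPn => //; rewrite -leNgt.
- have [pP|] := boolP (~: P \proper 'I_n); last first.
    move/properTP=> full; right=> j; rewrite leNgt; apply/negP => jP.
    by apply: full; exists j; rewrite !inE negbK.
  left=> j; rewrite -(coord_restrictDC P b) (part_norm_eq0 pP cob P0).
  rewrite addr0 mxE inE.
  by case: ifP => // /ltW.
Qed.

Lemma positive_root_reflection b bv j :
  root_coroot A b bv -> nonneg b ->
  b = delta_mx j 0 /\ bv = delta_mx j 0 \/
  nonneg (simple_reflection A j b).
Proof.
move=> rb b0; have cob := root_coproportional symA rb.
have [/existsP[k /andP[kj bk]]|] := boolP [exists k, (k != j) && (b k 0 != 0)].
  right; have [//|sb_le0] := root_sign (RootReflect j rb).
  have := sb_le0 k; rewrite !mxE andbT (negPf kj) mulr0 subr0 => le0.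
  by case/negP: bk; rewrite eq_le le0 b0.
rewrite negb_exists => /forallP b_supp; left.
have {}b_supp : supported [set j]%SET b.
  move=> k; rewrite inE => kj; have := b_supp k.
  by rewrite kj negbK => /eqP.
have bv_supp : supported [set j]%SET bv.
  move=> k /b_supp bk; have := coproportional_sgz symA k cob.
  by rewrite bk sgz0 => /eqP; rewrite sgz_eq0 => /eqP.
have := root_pairing gcmA rb; rewrite (supported_set1 b_supp).
rewrite (supported_set1 bv_supp) dotZl -scalemxAr linearZ /= dot_deltal.
rewrite -colE mxE (cartan_diag gcmA).
have := b0 j; move: (b j 0) (bv j 0) => x y x0 xy.
have yx : y * x = 1 by lia.
have /eqP : (absz y * absz x)%N = 1%N by rewrite -abszM yx.
rewrite muln_eq1 => /andP[_ /eqP x1].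
have {}x1 : x = 1 by lia.
by move: yx; rewrite x1 mulr1 => ->; rewrite scale1r.
Qed.

(* The word for s_b w, w the product of js, deletes a letter of js: reflecting b
   by the successive letters makes it simple, and then negative. *)
Lemma displacement_exchange m b bv js :
  nonneg m -> root_coroot A b bv -> nonneg b ->
  dot bv (displaced_labels A m js) < 0 ->
  exists2 js' : seq 'I_n, (size js' < size js)%N & displacement A js' *m m =
    displacement A js *m m + dot bv (displaced_labels A m js) *: b.
Proof.
move=> m0; elim: js b bv => [|j js IH] b bv rb b0.
  rewrite /displaced_labels mul0mx mulmx0 subr0 ltNge => /negP[].
  apply: dot_ge0 => // i.
  by rewrite (coproportional_ge0 symA i (root_coproportional symA rb)).
have sE : dot bv (displaced_labels A m (j :: js)) =
    dot (simple_reflection A^T j bv) (displaced_labels A m js).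
  by rewrite displaced_labels_cons dot_simple_reflectionl.
rewrite sE displacement_cons; set p := displaced_labels A m js in IH sE *.
have [[-> ->]|sb0] := positive_root_reflection j rb b0.
  move=> _; exists js => //.
  rewrite dotBl dotZl !dot_deltal -colE !mxE (cartan_diag gcmA).
  rewrite -addrA -scalerDl.
  by rewrite [X in X *: _](_ : _ = 0) ?scale0r ?addr0 //; ring.
set s := dot _ _ => s_lt0.
have [js' ltjs' js'E] := IH _ _ (root_coroot_reflection j rb) sb0 s_lt0.
exists (j :: js') => //; rewrite displacement_cons /displaced_labels js'E -/s.
rewrite mulmxDr opprD addrA -/(displaced_labels A m js) -/p.
have -> : (p - A *m (s *: simple_reflection A j b)) j 0 =
    p j 0 + s * (A *m b) j 0.
  rewrite -scalemxAr mxE [X in _ + X]mxE [X in - X]mxE.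
  by rewrite mulmx_simple_reflection_diag ?(cartan_diag gcmA) // mulrN opprK.
rewrite /simple_reflection; move: (displacement A js *m m) (A *m b) => c Ab.
by apply/colP => k; rewrite !mxE; ring.
Qed.

Lemma displacement_ge0 m js :
  nonneg m -> nonneg (displacement A js *m m).
Proof.
move=> m0; have [N] := ubnP (size js); elim: N js => // N IH [|i js] /= ltN k.
  by rewrite mul0mx mxE.
have delta0 : nonneg (delta_mx i 0 : 'cV[int]_n).
  by move=> l; rewrite mxE; case: (_ && _).
rewrite -/(displacement A (i :: js)) displacement_cons.
have [p0|p0] := lerP 0 (displaced_labels A m js i 0).
  by rewrite mxE addr_ge0 ?IH // mxE mulr_ge0.
have [|js' ltjs' js'E] :=
  displacement_exchange (js := js) m0 (RootSimple A i) delta0.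
  by rewrite dot_deltal; apply: p0.
rewrite dot_deltal in js'E; rewrite -js'E.
exact/IH/(leq_trans ltjs')/ltnW.
Qed.

Lemma reflections_norm js (x : 'cV[rat]_n) :
  let s := foldr (simple_reflection (ratmx A)) in
  dot (s x js) (S *m s x js) = dot x (S *m x).
Proof.
move=> s; elim: js => [|j js IH] //.
by rewrite /s /= (symmetrized_simple_reflection gcmA symA).
Qed.

(* If lambda - x is fixed by W_H, then x minus the displacement is the image of
   x under W_H, which acts by isometries. *)
Lemma displacement_coord_bounded H i k : H \proper 'I_n ->
  exists B : rat, forall js, all (fun j => j \in H) js ->
    `|(displacement A js k i)%:~R| <= B.
Proof.
move=> pH.
have [x [xH Sx]] :=
  basic_solution_exists affine_symmetrized (diag_mx e *m delta_mx i 0) pH.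
have [B leB] := supported_coord_le_form affine_symmetrized k pH.
exists (`|x k 0| + (dot x (S *m x) + B)) => js jsH.
pose c : 'cV[rat]_n := displacement (ratmx A) js *m delta_mx i 0.
have -> : (displacement A js k i)%:~R = c k 0.
  by rewrite /c -map_displacement -colE !mxE.
have xcE : x - c = foldr (simple_reflection (ratmx A)) x js.
  apply: displacement_reflections jsH _ => j jH; have := Sx j jH.
  rewrite symmetrized_mulE diag_mx_mulE.
  by apply: mulfI; rewrite gt_eqF ?symA.1.
have xcH : supported H (x - c).
  by apply: supportedB => //; apply: displacement_supported.
have := leB _ xcH; rewrite xcE reflections_norm -xcE => le_xc.
have -> : c k 0 = x k 0 - (x - c) k 0 by rewrite !mxE; ring.
by apply: le_trans (ler_normB _ _) _; rewrite lerD2l.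
Qed.

Lemma displacement_bounded H : H \proper 'I_n ->
  exists N : nat, forall js, all (fun j => j \in H) js ->
    forall k i, (absz (displacement A js k i) <= N)%N.
Proof.
move=> pH.
have /choice[B leB] (ki : 'I_n * 'I_n) : exists B : rat,
    forall js, all (fun j => j \in H) js ->
      `|(displacement A js ki.1 ki.2)%:~R| <= B.
  exact: (displacement_coord_bounded ki.2 ki.1 pH).
exists (Num.Def.archi_bound (\sum_ki B ki)) => js jsH k i.
have B0 ki : 0 <= B ki by apply: le_trans (leB ki [::] _).
apply: ltnW; rewrite -(@ltr_nat rat) natr_absz intr_norm.
apply: le_lt_trans (archi_boundP _); last by apply: sumr_ge0.
apply: le_trans (leB (k, i) _ jsH) _.
by rewrite (bigD1 (k, i)) //= lerDl sumr_ge0.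
Qed.

End AffineRoots.

(** * Rational convex hulls *)

Section RationalConvexHull.
Variables (C : numFieldType) (V : lmodType C).
Implicit Types (S : set V) (u v x y : V).

Lemma conv_rat_sum S (I : finType) (t : I -> rat) (x : I -> V) :
  (forall i, 0 <= t i) -> \sum_i t i = 1 -> (forall i, S (x i)) ->
  conv_rat S (\sum_i (ratr (t i) : C) *: x i).
Proof.
move=> t0 t1 Sx; exists #|I|, (t \o enum_val), (x \o enum_val).
split=> [k||k|] //=; first by rewrite -t1 [RHS]big_enum_val.
by rewrite big_enum_val.
Qed.

Lemma sub_conv_rat S S' : S `<=` S' -> conv_rat S `<=` conv_rat S'.
Proof.
move=> SS' _ [k [t [x [t0 t1 Sx ->]]]].
by apply: conv_rat_sum => // i; apply: SS'.
Qed.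

Lemma conv_rat_idem S : conv_rat (conv_rat S) `<=` conv_rat S.
Proof.
move=> _ [k [t [x [t0 t1 Sx ->]]]].
have /choice[p pP] i : exists p : {m : nat & ('I_m -> rat) * ('I_m -> V)}%type,
    [/\ forall j, 0 <= (tagged p).1 j, \sum_j (tagged p).1 j = 1,
        forall j, S ((tagged p).2 j)
      & x i = \sum_j (ratr ((tagged p).1 j) : C) *: (tagged p).2 j].
  by have [m [c [y P]]] := Sx i; exists (existT _ m (c, y)).
pose I := {i : 'I_k & 'I_(tag (p i))}.
pose s (q : I) := t (tag q) * (tagged (p (tag q))).1 (tagged q).
pose y (q : I) := (tagged (p (tag q))).2 (tagged q).
have -> : \sum_i (ratr (t i) : C) *: x i = \sum_q (ratr (s q) : C) *: y q.
  transitivity (\sum_i \sum_j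
      (ratr (t i * (tagged (p i)).1 j) : C) *: (tagged (p i)).2 j).
    apply: eq_bigr => i _; have [_ _ _ ->] := pP i; rewrite scaler_sumr.
    by apply: eq_bigr => j _; rewrite rmorphM scalerA.
  by rewrite sig_big_dep.
apply: conv_rat_sum => [q||q].
- by have [+ _ _ _] := pP (tag q) => p0; rewrite mulr_ge0.
- transitivity (\sum_i \sum_j t i * (tagged (p i)).1 j).
    by rewrite sig_big_dep.
  rewrite -[RHS]t1; apply: eq_bigr => i _; rewrite -mulr_sumr.
  by have [_ -> _ _] := pP i; rewrite mulr1.
- by have [_ _ + _] := pP (tag q); apply.
Qed.

Lemma conv_rat_midpoint S x y : S x -> S y -> conv_rat S (2^-1 *: (x + y)).
Proof.
move=> Sx Sy; pose z (b : bool) := if b then x else y.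
have -> : 2^-1 *: (x + y) = \sum_b (ratr (2^-1) : C) *: z b.
  by rewrite big_bool fmorphV /= ratr_nat scalerDr.
by apply: conv_rat_sum => [//||[]//]; rewrite big_bool /=; lra.
Qed.

Lemma conv_rat_translate S u :
  (forall x, S x -> conv_rat S (x - u)) ->
  forall v, conv_rat S v -> conv_rat S (v - u).
Proof.
move=> Su _ [k [t [x [t0 t1 Sx ->]]]]; apply: conv_rat_idem.
exists k, t, (fun i => x i - u); split=> // [i|]; first exact: Su.
under [RHS]eq_bigr do rewrite scalerBr.
by rewrite sumrB -scaler_suml -rmorph_sum t1 rmorph1 scale1r.
Qed.

End RationalConvexHull.

Lemma conv_rat_ge0 (n : nat) (K : set 'cV[rat]_n) :
  (forall c, K c -> nonneg c) -> forall c, conv_rat K c -> nonneg c.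
Proof.
move=> K0 _ [k [t [c [t0 _ Kc ->]]]] j; rewrite summxE; apply: sumr_ge0 => i _.
by rewrite mxE mulr_ge0 ?ler0q // K0.
Qed.

Lemma conv_rat_supported (n : nat) (H : {set 'I_n}) (K : set 'cV[rat]_n) :
  (forall c, K c -> supported H c) -> forall c, conv_rat K c -> supported H c.
Proof.
move=> KH _ [k [t [c [_ _ Kc ->]]]] j jH; rewrite summxE big1 // => i _.
by rewrite mxE (KH _ (Kc i) j jH) mulr0.
Qed.

(** * Weights and parabolic subgroups *)

Lemma finite_bounded_mx (m n N : nat) :
  finite_set [set M : 'M[int]_(m, n) | forall i j, (absz (M i j) <= N)%N].
Proof.
pose dec (B : 'M['I_(N + N).+1]_(m, n)) : 'M[int]_(m, n) :=
  \matrix_(i, j) ((B i j)%:Z - N%:Z).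
apply: (@sub_finite_set _ _ [set dec B | B in [set: 'M_(m, n)]]); last first.
  exact: finite_image finite_finset.
move=> M leN; exists (\matrix_(i, j) inord (absz (M i j + N%:Z))) => //.
by apply/matrixP => i j; have Mij := leN i j; rewrite !mxE inordK; lia.
Qed.

Section Weights.
Variables (C : numFieldType) (n : nat) (A : 'M[int]_n) (g : kac_moody C A).
Implicit Types (lambda mu nu : dual_cartan g) (js : seq 'I_n).
Let AC := map_mx (intr : int -> C) A.

Lemma pairingD mu nu x :
  pairing (mu + nu : dual_cartan g) x = pairing mu x + pairing nu x.
Proof. by rewrite /pairing add_lfunE. Qed.

Lemma pairingZ t mu x : pairing (t *: mu : dual_cartan g) x = t * pairing mu x.
Proof. by rewrite /pairing scale_lfunE. Qed.

Lemma pairing_sum (I : Type) (r : seq I) (F : I -> dual_cartan g) x :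
  pairing (\sum_(i <- r) F i) x = \sum_(i <- r) pairing (F i) x.
Proof. by rewrite /pairing sum_lfunE. Qed.

Definition root_comb (c : 'cV[C]_n) : dual_cartan g :=
  \sum_j c j 0 *: km_root g j.

Lemma root_comb_is_linear : linear root_comb.
Proof.
move=> t c c'; rewrite scaler_sumr -big_split; apply: eq_bigr => j _ /=.
by rewrite !mxE scalerDl scalerA.
Qed.

HB.instance Definition _ := GRing.isLinear.Build C 'cV[C]_n (dual_cartan g) *:%R
  root_comb root_comb_is_linear.

Definition dynkin_labels mu : 'cV[C]_n := \col_i pairing mu (km_coroot g i).

Lemma dynkin_labels_is_linear : linear dynkin_labels.
Proof. by move=> t mu nu; apply/colP => i; rewrite !mxE pairingD pairingZ. Qed.

HB.instance Definition _ := GRing.isLinear.Build C (dual_cartan g) 'cV[C]_n *:%R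
  dynkin_labels dynkin_labels_is_linear.

Lemma root_comb_delta k : root_comb (delta_mx k 0) = km_root g k.
Proof.
rewrite /root_comb (bigD1 k) //= mxE !eqxx scale1r.
rewrite big1 ?addr0 // => j /negPf jk.
by rewrite mxE jk scale0r.
Qed.

Lemma root_comb_shift c t k :
  root_comb (c + t *: delta_mx k 0) = root_comb c + t *: km_root g k.
Proof. by rewrite addrC linearP /= root_comb_delta addrC. Qed.

Lemma dynkin_labels_root k : dynkin_labels (km_root g k) = col k AC.
Proof. by apply/colP => i; rewrite !mxE /pairing km_pairing. Qed.

Lemma dynkin_labels_root_comb c : dynkin_labels (root_comb c) = AC *m c.
Proof.
rewrite linear_sum; apply/colP => i; rewrite summxE [RHS]mxE.
apply: eq_bigr => j _.
by rewrite linearZ /= dynkin_labels_root !mxE mulrC.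
Qed.

Lemma reflectionE i mu :
  reflection g i mu = mu - dynkin_labels mu i 0 *: km_root g i.
Proof. by rewrite lfunE /= mxE. Qed.

Lemma dynkin_labels_reflection i mu : dynkin_labels (reflection g i mu) =
  dynkin_labels mu - dynkin_labels mu i 0 *: col i AC.
Proof. by rewrite reflectionE linearB linearZ /= dynkin_labels_root. Qed.

Lemma reflection_root_comb i c :
  reflection g i (root_comb c) = root_comb (simple_reflection AC i c).
Proof.
rewrite reflectionE dynkin_labels_root_comb /simple_reflection -[in RHS]scaleNr.
by rewrite root_comb_shift scaleNr.
Qed.

Lemma reflectionK i : A i i = 2 -> involutive (reflection g i).
Proof.
move=> Aii mu; rewrite [LHS]reflectionE dynkin_labels_reflection reflectionE.
set p := dynkin_labels mu; have -> : (p - p i 0 *: col i AC) i 0 = - p i 0.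
  by rewrite !mxE Aii; ring.
by rewrite scaleNr opprK subrK.
Qed.

Lemma weyl_word_cons j js mu :
  weyl_word g (j :: js) mu = reflection g j (weyl_word g js mu).
Proof. exact: comp_lfunE. Qed.

Lemma weyl_word_cat js js' mu :
  weyl_word g (js ++ js') mu = weyl_word g js (weyl_word g js' mu).
Proof.
elim: js => [|j js IH]; first by rewrite id_lfunE.
by rewrite cat_cons !weyl_word_cons IH.
Qed.

Lemma weyl_word1 j mu : weyl_word g [:: j] mu = reflection g j mu.
Proof. by rewrite weyl_word_cons id_lfunE. Qed.

Lemma weyl_orbit_word js lambda : weyl_orbit lambda (weyl_word g js lambda).
Proof.
exists (weyl_word g js) => //; exists js => //.
by apply/allP => j _; rewrite inE.
Qed.

Lemma weyl_word_displacement js mu : weyl_word g js mu =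
  mu - root_comb (displacement AC js *m dynkin_labels mu).
Proof.
elim: js => [|j js IH]; first by rewrite id_lfunE mul0mx linear0 subr0.
rewrite weyl_word_cons IH reflectionE linearB /= dynkin_labels_root_comb.
by rewrite displacement_cons root_comb_shift opprD addrA.
Qed.

Lemma weyl_word_fixed js mu : dynkin_labels mu = 0 -> weyl_word g js mu = mu.
Proof.
by move=> mu0; rewrite weyl_word_displacement mu0 mulmx0 linear0 subr0.
Qed.

Lemma root_reflection_weyl_word b bv :
  (forall i, A i i = 2) -> root_coroot A b bv -> exists js, forall mu,
    weyl_word g js mu =
    mu - dot (map_mx intr bv) (dynkin_labels mu) *: root_comb (map_mx intr b).
Proof.
move=> A2; elim=> {b bv} [i|i b bv _ [js jsE]].
  exists [:: i] => mu; rewrite weyl_word1 reflectionE !map_delta_mx dot_deltal.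
  by rewrite root_comb_delta.
exists (i :: js ++ [:: i]) => mu.
rewrite weyl_word_cons weyl_word_cat weyl_word1.
rewrite jsE linearB linearZ /= reflection_root_comb reflectionK //.
rewrite dynkin_labels_reflection -dot_simple_reflectionl.
by rewrite /AC map_trmx -!map_simple_reflection.
Qed.

Definition lowered lambda (c : 'cV[rat]_n) : dual_cartan g :=
  lambda - root_comb (map_mx ratr c).

Lemma conv_rat_lowered lambda (K : set 'cV[rat]_n) :
  conv_rat (lowered lambda @` K) `<=` lowered lambda @` conv_rat K.
Proof.
move=> _ [k [t [x [t0 t1 xK ->]]]].
have /choice[c cP] i : exists c, K c /\ lowered lambda c = x i.
  by have [c] := xK i; exists c.
have ratr_rat q : ratr q = q :> rat by rewrite -(fmorph_eq_rat idfun).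
exists (\sum_i (ratr (t i) : rat) *: c i).
  by exists k, t, c; split=> // i; have [] := cP i.
have -> : lowered lambda (\sum_i (ratr (t i) : rat) *: c i) =
    \sum_i (ratr (t i) : C) *: lambda -
    root_comb (\sum_i (ratr (t i) : C) *: map_mx ratr (c i)).
  rewrite -scaler_suml -rmorph_sum t1 rmorph1 scale1r /lowered map_mx_sum.
  by congr (_ - root_comb _); apply: eq_bigr => i _; rewrite map_mxZ ratr_rat.
rewrite [root_comb _]linear_sum -sumrB; apply: eq_bigr => i _ /=.
by rewrite [root_comb _]linearZ -scalerBr; have [_ <-] := cP i.
Qed.

Lemma parabolic_orbit_sub (H : {set 'I_n}) lambda :
  [set w lambda | w in parabolic (g := g) H] `<=` weyl_orbit lambda.
Proof.
by move=> _ [_ [js _ ->] <-]; apply: weyl_orbit_word.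
Qed.

Section FiniteParabolic.
Variable H : {set 'I_n}.
Hypothesis finH : finite_set (parabolic (g := g) H).

Lemma size_parabolic_gt0 : (0 < #|` fset_set (parabolic (g := g) H)|)%N.
Proof.
rewrite cardfs_gt0; apply/fset0Pn; exists \1%VF.
by rewrite in_fset_set // inE; exists [::].
Qed.

Lemma bhat_conv lambda :
  conv_rat [set w lambda | w in parabolic (g := g) H] (bhat H lambda).
Proof.
have W0 := size_parabolic_gt0; set W := fset_set _ in W0.
have -> : bhat H lambda = \sum_(w : W)
    (ratr (#|` W|%:R^-1) : C) *: (val w : 'End(dual_cartan g)) lambda.
  rewrite -scaler_sumr fmorphV /= ratr_nat /bhat -/W; congr (_ *: _).
  by rewrite big_seq_fsetE.
apply: conv_rat_sum => [i||w]; first by rewrite invr_ge0.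
  by rewrite sumr_const cardfE -[LHS]mulr_natl mulfV // pnatr_eq0 -lt0n -cardfE.
exists (val w) => //; have := valP w.
by rewrite in_fset_set // inE.
Qed.

Lemma bhat_reflection lambda j : A j j = 2 -> j \in H ->
  reflection g j (bhat H lambda) = bhat H lambda.
Proof.
move=> Ajj jH; rewrite /bhat linearZ linear_sum /=; congr (_ *: _).
set W := fset_set _.
pose sj (w : 'End(dual_cartan g)) := (reflection g j \o w)%VF.
have sjK : involutive sj.
  by move=> w; apply/lfunP => mu; rewrite !comp_lfunE reflectionK.
have sjW w : w \in W -> sj w \in W.
  rewrite !in_fset_set // !inE => -[js jsH ->].
  by exists (j :: js) => //=; rewrite jH.
transitivity (\sum_(w <- map sj W) w lambda).
  by rewrite big_map; apply: eq_bigr => w _; rewrite comp_lfunE.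
apply: perm_big; apply: uniq_perm => [||w].
- by rewrite map_inj_uniq ?fset_uniq //; apply: inv_inj.
- exact: fset_uniq.
- apply/mapP/idP => [[v vW ->]|wW]; first exact: sjW.
  by exists (sj w); [exact: sjW|rewrite sjK].
Qed.

Lemma dynkin_labels_bhat lambda j : A j j = 2 -> j \in H ->
  dynkin_labels (bhat H lambda) j 0 = 0.
Proof.
move=> Ajj jH; have := bhat_reflection lambda Ajj jH; set mu := bhat H lambda.
move=> /(congr1 (fun nu => dynkin_labels nu j 0)).
rewrite dynkin_labels_reflection; move: (dynkin_labels mu) => p.
rewrite !mxE Ajj => /eqP; rewrite subr_eq addrC -subr_eq subrr eq_sym.
by rewrite mulf_eq0 pnatr_eq0 orbF => /eqP.
Qed.

End FiniteParabolic.

Lemma parabolic_finite (a : 'cV[int]_n) (e : 'rV[rat]_n) (H : {set 'I_n}) :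
  affine_cartan A a e -> H \proper 'I_n -> finite_set (parabolic (g := g) H).
Proof.
move=> affA pH.
have [N leN] := displacement_bounded affA pH.
pose word_of (D : 'M[int]_n) : 'End(dual_cartan g) :=
  (\1 - (linfun root_comb \o linfun (mulmx (map_mx intr D)) \o
          linfun dynkin_labels))%VF.
pose bounded := [set D : 'M[int]_n | forall k i, (absz (D k i) <= N)%N].
apply: (@sub_finite_set _ _ (word_of @` bounded)).
  move=> _ [js jsH ->]; exists (displacement A js); first exact: leN.
  apply/lfunP => mu; rewrite weyl_word_displacement.
  rewrite add_lfunE opp_lfunE id_lfunE.
  by rewrite !comp_lfunE !lfunE /= map_displacement.
exact/finite_image/finite_bounded_mx.
Qed.

End Weights.

(** * The dominant weight polyhedron of an affine algebra *)

Lemma affine_rank_ge (n : nat) (A : 'M[int]_n) (a : 'cV[int]_n)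
    (e : 'rV[rat]_n) :
  affine_cartan A a e -> (n <= (\rank (ratmx A)).+1)%N.
Proof.
move=> affA; have affS := affine_symmetrized affA.
have : (kermx (ratmx A)^T <= (ratmx a)^T)%MS.
  apply/row_subP => i; set u := row i _.
  have Au : ratmx A *m u^T = 0.
    by apply: trmx_inj; rewrite trmx_mul trmxK trmx0 /u -row_mul mulmx_ker row0.
  have [|s uE] := form_kernel affS (x := u^T).
    by rewrite /symmetrized -mulmxA Au mulmx0.
  by rewrite -[u]trmxK uE linearZ /= scalemx_sub.
move/mxrankS/leq_trans/(_ (rank_leq_row _)).
by rewrite mxrank_ker mxrank_tr leq_subLR addn1.
Qed.

Lemma reflections_midpoint (C : numFieldType) (V : lmodType C) (f f' : V -> C)
    (r r' v : V) :
  scalar f -> scalar f' -> f r = 2 -> f' r' = 2 -> f r' = - 2 -> f' r = - 2 ->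
  let s u := u - f u *: r in let s' u := u - f' u *: r' in
  2^-1 *: (s (s' v) + s' (s v)) = v - (f v + f' v) *: (r + r').
Proof.
move=> flin f'lin fr f'r' fr' f'r s s'; rewrite /s /s'.
have -> : f (v - f' v *: r') = f v + 2 * f' v.
  by rewrite addrC -scaleNr flin fr'; ring.
have -> : f' (v - f v *: r) = f' v + 2 * f v.
  by rewrite addrC -scaleNr f'lin f'r; ring.
rewrite -!scaleNr.
have -> : v + - f' v *: r' + - (f v + 2 * f' v) *: r +
    (v + - f v *: r + - (f' v + 2 * f v) *: r') =
    2 *: v + (- (2 * (f v + f' v))) *: (r + r').
  rewrite addrACA [X in X + _]addrACA -addrA -mulr2n -scaler_nat; congr (_ + _).
  rewrite [X in X + _]addrC addrACA -!scalerDl scalerDr.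
  by congr (_ *: _ + _ *: _); ring.
have two0 : 2 != 0 :> C by rewrite pnatr_eq0.
by rewrite scalerDr !scalerA mulrN mulKf // mulVf // scale1r.
Qed.

Section AffineWeights.
Variables (C : numFieldType) (n : nat) (A : 'M[int]_n) (a : 'cV[int]_n).
Variable e : 'rV[rat]_n.
Hypothesis affA : affine_cartan A a e.
Variables (g : kac_moody C A) (o : 'I_n) (d : km_cartan g).
Hypothesis pairing_root_d : forall i, pairing (km_root g i) d = (i == o)%:R.
Implicit Types (mu lambda : dual_cartan g) (H : {set 'I_n}) (c : 'cV[rat]_n).
Let S := symmetrized A e.
Let affS := affine_symmetrized affA.
Let n_gt0 : (0 < n)%N := (affine_indecomposable affA).1.

Definition imaginary_root : dual_cartan g := root_comb g (map_mx intr a).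

Lemma dynkin_labels_imaginary_root : dynkin_labels imaginary_root = 0.
Proof.
by rewrite dynkin_labels_root_comb -map_mxM (mul_marks affA) map_mx0.
Qed.

Lemma pairing_root_comb_d (c : 'cV[C]_n) : pairing (root_comb g c) d = c o 0.
Proof.
rewrite pairing_sum (bigD1 o) //= pairingZ pairing_root_d eqxx mulr1.
rewrite big1 ?addr0 // => j /negPf jo.
by rewrite pairingZ pairing_root_d jo mulr0.
Qed.

Lemma pairing_imaginary_root_d : pairing imaginary_root d = (a o 0)%:~R.
Proof. by rewrite pairing_root_comb_d mxE. Qed.

(* The coroots and d form a basis of the Cartan subalgebra, whose dimension is
   at most n + 1 because A has corank 1. *)
Lemma weight_eq0 mu : dynkin_labels mu = 0 -> pairing mu d = 0 -> mu = 0.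
Proof.
move=> mu0 mud; pose X := [seq km_coroot g i | i <- enum 'I_n].
have sub_lker (nu : dual_cartan g) :
    dynkin_labels nu = 0 -> (<<X>> <= lker nu)%VS.
  move=> /colP nu0; apply/span_subvP => x /mapP[i _ ->].
  by rewrite memv_ker; apply/eqP; have := nu0 i; rewrite !mxE.
have freeX : free (d :: X).
  rewrite free_cons km_coroot_free andbT; apply/negP => dX.
  have := subvP (sub_lker _ dynkin_labels_imaginary_root) d dX.
  rewrite memv_ker; apply/negP.
  rewrite -[X in X != _]/(pairing imaginary_root d) pairing_imaginary_root_d.
  by rewrite intr_eq0 gt_eqF ?(marks_gt0 affA).
have full : (<<d :: X>> = fullv)%VS.
  apply/eqP; rewrite eqEdim subvf /= (eqnP freeX) /= size_map size_enum_ord.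
  have := km_dim g; have := affine_rank_ge affA.
  by rewrite -(map_ratr_intmx C A) mxrank_map; lia.
apply/lfunP => x; rewrite zero_lfunE; apply/eqP; rewrite -memv_ker.
move: (memvf x); rewrite -full; apply/subvP/span_subvP => y.
rewrite inE => /orP[/eqP ->|yX]; first by rewrite memv_ker; apply/eqP.
exact/(subvP (sub_lker _ mu0))/memv_span.
Qed.

Lemma imaginary_root_midpoint i bv lambda :
  root_coroot A (a - delta_mx i 0) bv ->
  exists js js', lambda - (dynkin_labels lambda i 0 +
      dot (map_mx intr bv) (dynkin_labels lambda)) *: imaginary_root =
    2^-1 *: (weyl_word g js lambda + weyl_word g js' lambda).
Proof.
move=> rb; have A2 := cartan_diag (affine_gcm affA).
have [js jsE] := root_reflection_weyl_word g A2 rb.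
pose f mu := dynkin_labels mu i 0.
pose f' mu := dot (map_mx intr bv) (dynkin_labels mu).
set r' := root_comb g _ in jsE; pose r := km_root g i.
have rr' : r + r' = imaginary_root.
  rewrite /r' map_mxB map_delta_mx linearB /= root_comb_delta.
  by rewrite addrCA subrr addr0.
have flin : scalar f by move=> t mu nu; rewrite /f linearP !mxE.
have f'lin : scalar f' by move=> t mu nu; rewrite /f' linearP linearP.
have fr : f r = 2 by rewrite /f dynkin_labels_root !mxE A2.
have f'r' : f' r' = 2.
  rewrite /f' dynkin_labels_root_comb -map_mxM dot_map.
  by rewrite (root_pairing (affine_gcm affA) rb).
have labels_r' : dynkin_labels r' = - dynkin_labels r.
  apply/eqP; rewrite -subr_eq0 opprK -linearD addrC /=.
  by rewrite rr' dynkin_labels_imaginary_root.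
have fr' : f r' = - 2 by rewrite /f labels_r' mxE -/(f r) fr.
have f'r : f' r = - 2.
  by rewrite /f' -[dynkin_labels r]opprK -labels_r' linearN /= -/(f' r') f'r'.
exists (i :: js), (js ++ [:: i]).
rewrite weyl_word_cons weyl_word_cat weyl_word1 !jsE !reflectionE -rr'.
by rewrite -(reflections_midpoint lambda flin f'lin fr f'r' fr' f'r).
Qed.

Lemma conv_orbit_shift i bv lambda (k : C) :
  root_coroot A (a - delta_mx i 0) bv ->
  k = dynkin_labels lambda i 0 + dot (map_mx intr bv) (dynkin_labels lambda) ->
  forall mu, conv_rat (weyl_orbit lambda) mu ->
    conv_rat (weyl_orbit lambda) (mu - k *: imaginary_root).
Proof.
move=> rb ->; have [js [js' midE]] := imaginary_root_midpoint lambda rb.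
apply: conv_rat_translate => _ [_ [ws _ ->] <-].
rewrite -[_ *: imaginary_root](weyl_word_fixed ws); last first.
  by rewrite linearZ /= dynkin_labels_imaginary_root scaler0.
rewrite -linearB midE linearZ linearD /= -!weyl_word_cat.
by apply: conv_rat_midpoint; apply: weyl_orbit_word.
Qed.

Variable Lam : 'I_n -> dual_cartan g.
Hypothesis hLam : fundamental_weights d Lam.
Let hQ := rational_weights Lam imaginary_root.

Lemma mark_neq0 : (a o 0)%:~R != 0 :> rat.
Proof. by rewrite intr_eq0 gt_eqF ?(marks_gt0 affA). Qed.

Lemma rational_weightsP mu : hQ mu <-> exists (p : 'cV[rat]_n) (b : rat),
  dynkin_labels mu = map_mx ratr p /\ pairing mu d = ratr b.
Proof.
have [LamC Lamd] := hLam.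
pose weight (p : 'I_n -> rat) (b : rat) : dual_cartan g :=
  \sum_i (ratr (p i) : C) *: Lam i + (ratr b : C) *: imaginary_root.
have labelsE p b : dynkin_labels (weight p b) = \col_i ratr (p i).
  rewrite linearD linearZ /= dynkin_labels_imaginary_root scaler0 addr0.
  apply/colP => i; rewrite !mxE pairing_sum (bigD1 i) //= pairingZ LamC eqxx.
  rewrite mulr1 big1 ?addr0 // => j /negPf ji.
  by rewrite pairingZ LamC ji mulr0.
have dE p b : pairing (weight p b) d = ratr (b * (a o 0)%:~R).
  rewrite pairingD pairingZ pairing_imaginary_root_d pairing_sum.
  rewrite big1 => [|j _]; last by rewrite pairingZ Lamd mulr0.
  by rewrite add0r rmorphM /= ratr_int.
split=> [[p [b ->]]|[p [b [muC mud]]]].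
  exists (\col_i p i), (b * (a o 0)%:~R); split; last exact: dE.
  by rewrite -/(weight _ _) labelsE; apply/colP => i; rewrite !mxE.
exists (p^~ 0), (b / (a o 0)%:~R).
apply/eqP; rewrite -subr_eq0 -/(weight _ _); apply/eqP/weight_eq0.
  by rewrite linearB /= labelsE muC; apply/colP => i; rewrite !mxE subrr.
by rewrite -scaleN1r pairingD pairingZ dE divfK ?mark_neq0 // mud mulN1r subrr.
Qed.

Lemma rational_weights_lin (t : rat) mu nu :
  hQ mu -> hQ nu -> hQ ((ratr t : C) *: mu + nu).
Proof.
move=> /rational_weightsP[p [b [mup mub]]].
move=> /rational_weightsP[p' [b' [nup nub]]].
apply/rational_weightsP; exists (t *: p + p'), (t * b + b').
rewrite linearP /= mup nup map_mxD map_mxZ pairingD pairingZ mub nub.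
by rewrite rmorphD rmorphM.
Qed.

Lemma rational_weights_root j : hQ (km_root g j).
Proof.
apply/rational_weightsP; exists (ratmx (col j A)), (j == o)%:R.
by rewrite dynkin_labels_root map_ratr_intmx map_col pairing_root_d ratr_nat.
Qed.

Lemma rational_weights_root_sum (t : 'I_n -> rat) (js : seq 'I_n) mu :
  hQ mu -> hQ (\sum_(j <- js) (ratr (t j) : C) *: km_root g j + mu).
Proof.
move=> hmu; elim: js => [|j js IH]; first by rewrite big_nil add0r.
rewrite big_cons -addrA.
exact: rational_weights_lin (rational_weights_root j) IH.
Qed.

Lemma loweredE lambda c :
  lowered lambda c = \sum_j (ratr (- c j 0) : C) *: km_root g j + lambda.
Proof.
rewrite /lowered addrC -scaleN1r scaler_sumr; congr (_ + _).
apply: eq_bigr => j _.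
by rewrite mxE scalerA mulN1r rmorphN.
Qed.

Lemma rational_weights_lowered lambda c : hQ lambda -> hQ (lowered lambda c).
Proof. by rewrite loweredE; apply: rational_weights_root_sum. Qed.

Lemma rational_linear_lowered (f : dual_cartan g -> rat) lambda c :
  rational_linear_on hQ f -> hQ lambda ->
  f (lowered lambda c) = f lambda - dot (\col_j f (km_root g j)) c.
Proof.
move=> flin hlambda; rewrite loweredE [RHS]addrC -sumrN.
under [X in _ = X + _]eq_bigr do rewrite mxE mulrC -mulNr.
elim: (index_enum _) => [|j js IH]; first by rewrite !big_nil !add0r.
rewrite !big_cons -!addrA flin ?IH //; first exact: rational_weights_root.
exact: rational_weights_root_sum.
Qed.

Lemma rational_functional (y : 'cV[rat]_n) (t : rat) :
  exists f : dual_cartan g -> rat, forall mu (p : 'cV[rat]_n) (b : rat),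
    dynkin_labels mu = map_mx ratr p -> pairing mu d = ratr b ->
    f mu = dot y p + t * b.
Proof.
pose value mu : set rat := [set q | exists (p : 'cV[rat]_n) (b : rat),
  [/\ dynkin_labels mu = map_mx ratr p, pairing mu d = ratr b
    & q = dot y p + t * b]].
exists (fun mu => xget 0 (value mu)) => mu p b mup mub.
have [p' [b' [mup' mub' ->]]] : value mu (xget 0 (value mu)).
  by apply: xgetPex; exists (dot y p + t * b), p, b.
move: mup' mub'; rewrite mup mub => pp' /fmorph_inj <-.
by rewrite (map_mx_inj pp').
Qed.

Lemma functional_of_root_values (q : 'cV[rat]_n) :
  exists2 f : dual_cartan g -> rat, rational_linear_on hQ f &
    forall j, f (km_root g j) = q j 0.
Proof.
pose t := dot (ratmx a) q / (a o 0)%:~R.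
have [|u Su] := form_range affS (q := q - t *: delta_mx o 0).
  rewrite linearB linearZ /= [dot _ (delta_mx _ _)]dotC dot_deltal mxE.
  by rewrite divfK ?subrr ?mark_neq0.
have [f fE] := rational_functional (diag_mx e *m u) t.
exists f => [s mu nu|j].
  move=> /rational_weightsP[p [b [mup mub]]].
  move=> /rational_weightsP[p' [b' [nup nub]]].
  rewrite (fE _ _ _ mup mub) (fE _ _ _ nup nub).
  rewrite (fE _ (s *: p + p') (s * b + b')).
  - by rewrite linearP /=; ring.
  - by rewrite linearP /= mup nup map_mxD map_mxZ.
  - by rewrite pairingD pairingZ mub nub rmorphD rmorphM.
rewrite (fE _ (ratmx (col j A)) (j == o)%:R); last 1 first.
- by rewrite pairing_root_d ratr_nat.
- rewrite map_col dot_col mulmxA -(affine_symmetrizer affA).2.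
  rewrite -/(symmetrized A e) Su.
  by rewrite !mxE andbT subrK.
- by rewrite dynkin_labels_root map_ratr_intmx map_col.
Qed.

Section DominantPolyhedron.
Variables (lambda : dual_cartan g) (m : 'cV[int]_n).
Hypothesis hQ_lambda : hQ lambda.
Hypothesis labels_lambda : dynkin_labels lambda = map_mx intr m.
Hypothesis m_ge0 : nonneg m.
Let scaled_labels : 'cV[rat]_n := diag_mx e *m ratmx m.
Let D := dominant_weight_polyhedron hQ lambda.

Lemma dynkin_labels_lowered c :
  dynkin_labels (lowered lambda c) = map_mx ratr (ratmx m - ratmx A *m c).
Proof.
rewrite linearB /= labels_lambda dynkin_labels_root_comb.
by rewrite map_mxB map_mxM !map_ratr_intmx.
Qed.

Lemma pairing_lowered_ge0 c j :
  (0 <= pairing (lowered lambda c) (km_coroot g j)) =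
  ((S *m c) j 0 <= scaled_labels j 0).
Proof.
have /colP/(_ j) := dynkin_labels_lowered c; rewrite [LHS]mxE => ->.
rewrite symmetrized_mulE /scaled_labels diag_mx_mulE.
rewrite ler_pM2l ?(affine_symmetrizer affA).1 //.
by rewrite mxE ler0q mxE [X in _ + X]mxE subr_ge0.
Qed.

Lemma scaled_labels_ge0 : nonneg scaled_labels.
Proof.
move=> j; rewrite /scaled_labels diag_mx_mulE mxE mulr_ge0 ?ler0z //.
exact: ltW ((affine_symmetrizer affA).1 j).
Qed.

Lemma weyl_word_lowered js :
  weyl_word g js lambda = lowered lambda (ratmx (displacement A js *m m)).
Proof.
rewrite weyl_word_displacement labels_lambda /lowered map_ratr_intmx.
by rewrite map_mxM map_displacement.
Qed.

Lemma conv_orbit_shift_gt0 i bv :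
  root_coroot A (a - delta_mx i 0) bv -> 0 < m i 0 ->
  exists2 k : rat, 0 < k & forall mu, conv_rat (weyl_orbit lambda) mu ->
    conv_rat (weyl_orbit lambda) (mu - (ratr k : C) *: imaginary_root).
Proof.
move=> rb mi_gt0; exists (m i 0 + dot bv m)%:~R.
  rewrite ltr0z ltr_wpDr // dot_ge0 // => j.
  rewrite (coproportional_ge0 (affine_symmetrizer affA) j
             (root_coproportional (affine_symmetrizer affA) rb)) !mxE subr_ge0.
  by have := marks_gt0 affA j; case: (_ && _) => //= /ltW.
apply: (conv_orbit_shift rb).
by rewrite labels_lambda dot_map ratr_int mxE rmorphD.
Qed.

Lemma bhat_basic_solution H : H \proper 'I_n ->
  exists2 c, basic_solution S scaled_labels H c
           & bhat H lambda = lowered lambda c.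
Proof.
move=> pH; have finH := parabolic_finite g affA pH.
have [|c cK cE] :=
  @conv_rat_lowered _ _ _ _ lambda [set c | supported H c] (bhat H lambda).
  apply: sub_conv_rat (bhat_conv finH lambda) => _ [_ [js jsH ->] <-].
  exists (ratmx (displacement A js *m m)); last by rewrite weyl_word_lowered.
  by move=> j jH; rewrite mxE (displacement_supported A m jsH).
exists c => //; split=> [|j jH]; first exact: conv_rat_supported cK.
have := dynkin_labels_bhat finH lambda (cartan_diag (affine_gcm affA) j) jH.
rewrite -cE dynkin_labels_lowered mxE => /eqP.
rewrite fmorph_eq0 mxE [X in _ + X]mxE subr_eq0 => /eqP mE.
by rewrite symmetrized_mulE -mE /scaled_labels diag_mx_mulE.
Qed.

Lemma polyhedron_cut_orthant mu :
  D mu -> exists2 c, cut_orthant S scaled_labels c & mu = lowered lambda c.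
Proof.
move=> [[_ mu_dom] mu_conv].
have [|c cK muE] :=
  @conv_rat_lowered _ _ _ _ lambda [set c | nonneg c] mu.
  apply: sub_conv_rat mu_conv => _ [_ [js _ ->] <-].
  exists (ratmx (displacement A js *m m)); last by rewrite weyl_word_lowered.
  by move=> j; rewrite mxE ler0z (displacement_ge0 affA).
exists c => //; split=> j; first exact: conv_rat_ge0 cK _.
by have := mu_dom j; rewrite -muE pairing_lowered_ge0.
Qed.

Lemma bhat_in_polyhedron H : H \proper 'I_n -> D (bhat H lambda).
Proof.
move=> pH; have [c cP bE] := bhat_basic_solution pH.
have finH := parabolic_finite g affA pH.
split; last first.
  exact/(sub_conv_rat (@parabolic_orbit_sub _ _ _ _ _ _))/(bhat_conv finH).
split; rewrite bE; first exact: rational_weights_lowered.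
move=> j; rewrite pairing_lowered_ge0.
by have [_] := basic_solution_cut_orthant affS scaled_labels_ge0 pH cP.
Qed.

Lemma bhat_is_vertex H : H \proper 'I_n -> vertices hQ D (bhat H lambda).
Proof.
move=> pH; have [c cP bE] := bhat_basic_solution pH.
have [q q_min] := basic_solution_exposed affS pH cP.
have [f flin fq] := functional_of_root_values q.
have fE c' : f (lowered lambda c') = f lambda - dot q c'.
  rewrite (rational_linear_lowered c' flin hQ_lambda).
  by congr (_ - dot _ _); apply/colP => j; rewrite mxE fq.
split; first by exists (bhat H lambda).
exists f, (f (bhat H lambda)); rewrite bE fE; split=> //.
  by move=> _ /polyhedron_cut_orthant[c' /q_min[qc' _] ->]; rewrite fE lerB.
apply/seteqP; split=> mu /= => [->|].
  by rewrite fE -bE; split=> //; apply: bhat_in_polyhedron.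
move=> [/polyhedron_cut_orthant[c' /q_min[_ c'c] ->]].
by rewrite fE => /addrI/oppr_inj/c'c ->.
Qed.

Lemma lowered_shift c (k : rat) :
  lowered lambda c - (ratr k : C) *: imaginary_root =
  lowered lambda (c + k *: ratmx a).
Proof.
rewrite /lowered -addrA -opprD map_mxD map_mxZ map_ratr_intmx.
by rewrite [root_comb g _ in RHS]linearD linearZ.
Qed.

Lemma polyhedron_shift c (k : rat) :
  (forall mu, conv_rat (weyl_orbit lambda) mu ->
     conv_rat (weyl_orbit lambda) (mu - (ratr k : C) *: imaginary_root)) ->
  D (lowered lambda c) -> D (lowered lambda (c + k *: ratmx a)).
Proof.
move=> shift [[_ c_dom] /shift]; rewrite lowered_shift => ck_conv.
split=> //; split=> [|j]; first exact: rational_weights_lowered.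
have := c_dom j; rewrite !pairing_lowered_ge0 mulmxDr -scalemxAr.
by rewrite (form_null affS) scaler0 addr0.
Qed.

Lemma vertex_is_bhat i bv v : root_coroot A (a - delta_mx i 0) bv ->
  0 < m i 0 -> vertices hQ D v ->
  exists2 H : {set 'I_n}, H \proper 'I_n & bhat H lambda = v.
Proof.
move=> rb mi_gt0 [_ [f [M [flin fmax vE]]]].
have [Dv fv] : D v /\ f v = M by have : [set v] v by []; rewrite vE.
have [c cP vc] := polyhedron_cut_orthant Dv.
pose q := \col_j f (km_root g j).
have fE c' : f (lowered lambda c') = f lambda - dot q c' :=
  rational_linear_lowered c' flin hQ_lambda.
have qa : 0 <= dot q (ratmx a).
  have [k k0 shift] := conv_orbit_shift_gt0 rb mi_gt0.
  have Dc : D (lowered lambda c) by rewrite -vc.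
  have := fmax _ (polyhedron_shift shift Dc); rewrite -fv vc !fE lerD2l lerN2.
  by rewrite linearD linearZ /= lerDl pmulr_rge0.
have [H [u [feasible slack_ge0]]] := linear_complementarity affS n_gt0 qa.
have [pH _ _] := feasible; exists H => //.
have [c' c'P bE] := bhat_basic_solution pH.
suff : [set v] (bhat H lambda) by [].
rewrite vE; have Db := bhat_in_polyhedron pH; split=> //.
apply/le_anti; rewrite fmax //= -fv bE vc !fE lerB //.
exact: (basic_solution_minimizes affS feasible slack_ge0 c'P cP).
Qed.

Theorem vertices_affine_polyhedron i bv :
  root_coroot A (a - delta_mx i 0) bv -> 0 < m i 0 ->
  vertices hQ D =
  [set bhat H lambda | H in [set H : {set 'I_n} | H \proper 'I_n]].
Proof.
move=> rb mi_gt0; apply/seteqP; split=> [v|_ [H pH <-]].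
  by move=> /(vertex_is_bhat rb mi_gt0)[H pH <-]; exists H.
exact: bhat_is_vertex.
Qed.

End DominantPolyhedron.
End AffineWeights.

(** * Untwisted affine matrices *)

Section Untwisted.
Variables (l : nat) (Afin : 'M[int]_l) (theta thetav : 'cV[int]_l).
Hypothesis (hA : simple_cartan_matrix Afin).
Hypothesis (htheta : highest_root Afin theta thetav).
Let A := untwisted_affine_matrix Afin theta thetav.

Definition untwisted_marks : 'cV[int]_(1 + l) := col_mx 1%:M theta.

Lemma untwisted_matrix00 : A (lshift l 0) (lshift l 0) = 2.
Proof. by rewrite block_mxEul mxE. Qed.

Lemma untwisted_matrix0r j :
  A (lshift l 0) (rshift 1 j) = - (Afin^T *m thetav) j 0.
Proof. by rewrite block_mxEur mxE -[Afin in LHS]trmxK -trmx_mul mxE. Qed.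

Lemma untwisted_matrixr0 i :
  A (rshift 1 i) (lshift l 0) = - (Afin *m theta) i 0.
Proof. by rewrite block_mxEdl mxE. Qed.

Lemma untwisted_matrixrr i j : A (rshift 1 i) (rshift 1 j) = Afin i j.
Proof. by rewrite block_mxEdr. Qed.

Lemma highest_root_ge1 i : 1 <= theta i 0.
Proof. by have := htheta.2 _ _ (RootSimple Afin i) i; rewrite mxE !eqxx. Qed.

Lemma highest_root_dominant i : 0 <= (Afin *m theta) i 0.
Proof.
have := htheta.2 _ _ (RootReflect i htheta.1) i; move: (Afin *m theta) => y.
by rewrite !mxE !eqxx mulr1 gerDl oppr_le0.
Qed.

Lemma simple_cartan_gcm : generalized_cartan_matrix Afin.
Proof. by case: hA. Qed.

Lemma highest_root_pairing : dot thetav (Afin *m theta) = 2.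
Proof. exact: (root_pairing simple_cartan_gcm htheta.1). Qed.

Lemma simple_cartan_symmetrizer : exists e, symmetrizer Afin e.
Proof.
have [_ _ [e [e0 eA _]]] := hA; exists (\row_i e i); apply/symmetrizerP.
by split=> [i|i j]; rewrite !mxE.
Qed.

Lemma highest_root_coproportional e : symmetrizer Afin e ->
  coproportional e (Afin *m theta) (Afin^T *m thetav).
Proof.
move=> symA; have [t t0 tE] := root_coproportional symA htheta.1.
by exists t => //; rewrite !map_mxM -map_trmx scalemxAr tE !mulmxA symA.2.
Qed.

Lemma untwisted_symmetrizer : exists e, symmetrizer A e.
Proof.
have [e symA] := simple_cartan_symmetrizer.
have [e0 eA] := (symmetrizerP _ _).1 symA.
have [t t0 tE] := coproportional_coord (highest_root_coproportional symA).
exists (row_mx t%:M e); apply/symmetrizerP; split=> [i|i j].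
  by case: (split_ordP i) => k ->; rewrite ?row_mxEl ?row_mxEr ?mxE ?ord1.
case: (split_ordP i) => k ->; case: (split_ordP j) => k' ->;
  rewrite ?(ord1 k) ?(ord1 k') // ?row_mxEl ?row_mxEr ?[t%:M _ _]mxE
    ?untwisted_matrix0r ?untwisted_matrixr0 ?untwisted_matrixrr //.
- by rewrite !rmorphN /= !mulrN tE.
- by rewrite !rmorphN /= !mulrN tE.
Qed.

Lemma untwisted_gcm : generalized_cartan_matrix A.
Proof.
have [diagF offF _] := simple_cartan_gcm.
have [e symA] := simple_cartan_symmetrizer.
have coA := highest_root_coproportional symA.
split=> [i|i j ij|i j].
- case: (split_ordP i) => k ->; first by rewrite ord1 untwisted_matrix00.
  by rewrite untwisted_matrixrr.
- move: ij; case: (split_ordP i) => k ->; case: (split_ordP j) => k' ->;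
    rewrite ?(ord1 k) ?(ord1 k') ?eqxx //.
  + rewrite untwisted_matrix0r oppr_le0 (coproportional_ge0 symA _ coA).
    by rewrite highest_root_dominant.
  + by rewrite untwisted_matrixr0 oppr_le0 highest_root_dominant.
  + by rewrite untwisted_matrixrr eq_rshift => /offF.
- by have [e' /symmetrizer_eq0] := untwisted_symmetrizer; apply.
Qed.

Lemma untwisted_marks_gt0 i : 0 < untwisted_marks i 0.
Proof.
case: (split_ordP i) => k ->; first by rewrite col_mxEu ord1 mxE.
by rewrite col_mxEd (lt_le_trans _ (highest_root_ge1 k)).
Qed.

Lemma untwisted_mul_marks : A *m untwisted_marks = 0.
Proof.
rewrite /A /untwisted_affine_matrix mul_block_col !mulmx1 mulNmx -mulmxA.
by rewrite trmx_mul_dot highest_root_pairing subrr addNr col_mx0.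
Qed.

Lemma untwisted_indecomposable : indecomposable_matrix A.
Proof.
have [_ _ A_tr] := untwisted_gcm; have [_ [l0 indF] _] := hA.
split=> // J.
wlog J0 : J / lshift l 0 \in J => [wlogJ|].
  have [/wlogJ//|J0 [i iJ] [j jJ]] := boolP (lshift l 0 \in J).
  have [|||i' [j' [iJ' jJ' Aij]]] := wlogJ (~: J).
  - by rewrite inE.
  - by exists j; rewrite inE.
  - by exists i; rewrite inE negbK.
  rewrite !inE negbK in iJ' jJ'; exists j', i'; split=> //.
  by apply: contra_neq Aij => /A_tr.
move=> _ [j jJ].
case: (split_ordP j) => k jE; first by rewrite jE ord1 J0 in jJ.
have [/existsP[i iJ]|] := boolP [exists i, rshift 1 i \in J].
  have [||i' [j' [iJ' jJ' Aij]]] := indF [set i | rshift 1 i \in J]%SET.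
  - by exists i; rewrite inE.
  - by exists k; rewrite inE -jE.
  rewrite !inE in iJ' jJ'.
  by exists (rshift 1 i'), (rshift 1 j'); rewrite untwisted_matrixrr.
rewrite negb_exists => /forallP Jfin.
have [/existsP[j' Aj']|] := boolP [exists j', (Afin^T *m thetav) j' 0 != 0].
  by exists (lshift l 0), (rshift 1 j'); rewrite untwisted_matrix0r oppr_eq0.
rewrite negb_exists => /forallP A0; have := highest_root_pairing.
rewrite dot_mulmxr /dot big1 // => i _; have := A0 i.
by rewrite negbK => /eqP ->; rewrite mul0r.
Qed.

Lemma untwisted_affine_cartan : exists e, affine_cartan A untwisted_marks e.
Proof.
have [e symA] := untwisted_symmetrizer; exists e; split=> //.
- exact: untwisted_gcm.
- exact: untwisted_indecomposable.
- exact: untwisted_marks_gt0.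
- exact: untwisted_mul_marks.
Qed.

Lemma root_coroot_untwisted b bv : root_coroot Afin b bv ->
  root_coroot A (col_mx 0 b) (col_mx 0 bv).
Proof.
have deltaE i :
    delta_mx (rshift 1 i) 0 = col_mx 0 (delta_mx i 0) :> 'cV[int]_(1 + l).
  apply/colP => k; case: (split_ordP k) => k' ->.
    by rewrite col_mxEu !mxE eq_lrshift.
  by rewrite col_mxEd !mxE eq_rshift.
elim=> {b bv} [i|i b bv _ IH]; first by rewrite -deltaE; apply: RootSimple.
have := RootReflect (rshift 1 i) IH.
rewrite deltaE !scale_col_mx !scaler0 !opp_col_mx !add_col_mx !subr0.
rewrite {1 2}/A /untwisted_affine_matrix tr_block_mx !mul_block_col.
by rewrite !mulmx0 !add0r !col_mxEd.
Qed.

Lemma highest_root_untwisted :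
  root_coroot A (untwisted_marks - delta_mx (lshift l 0) 0) (col_mx 0 thetav).
Proof.
suff -> : untwisted_marks - delta_mx (lshift l 0) 0 = col_mx 0 theta.
  exact: root_coroot_untwisted htheta.1.
apply/colP => i; rewrite mxE [X in _ + X]mxE [delta_mx _ _ _ _]mxE andbT.
case: (split_ordP i) => k ->; rewrite ?col_mxEu ?col_mxEd.
  by rewrite ord1 !mxE eqxx subrr.
by rewrite eq_rlshift subr0.
Qed.

Lemma basic_imaginary_rootE (C : numFieldType) (g : kac_moody C A) :
  basic_imaginary_root g = imaginary_root untwisted_marks g.
Proof.
rewrite /imaginary_root /root_comb big_split_ord /= big_ord1.
rewrite mxE col_mxEu mxE scale1r; congr (_ + _); apply: eq_bigr => i _.
by rewrite mxE col_mxEd.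
Qed.

End Untwisted.

Theorem corollary3p10 (R : realType) (l : nat) (Afin : 'M[int]_l)
    (theta thetav : 'cV[int]_l)
    (hA : simple_cartan_matrix Afin)
    (htheta : highest_root Afin theta thetav)
    (g : kac_moody (complex R) (untwisted_affine_matrix Afin theta thetav))
    (d : km_cartan g) (hd : is_derivation_element d)
    (Lam : 'I_(1 + l) -> dual_cartan g) (hLam : fundamental_weights d Lam)
    (lambda : dual_cartan g)
    (hdom : dominant_integral lambda) (hreg : regular_dominant lambda)
    (hlambda : pairing lambda d = 0) :
  let hQ := rational_weights Lam (basic_imaginary_root g) in
  vertices hQ (dominant_weight_polyhedron hQ lambda) =
  [set bhat H lambda | H in [set H : {set 'I_(1 + l)} | H \proper 'I_(1 + l)]].
Proof.
have [k kE] := choice hdom; pose m : 'cV[int]_(1 + l) := \col_i (k i)%:Z.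
have [e affA] := untwisted_affine_cartan hA htheta.
have labels_lambda : dynkin_labels lambda = map_mx intr m.
  by apply/colP => i; rewrite !mxE kE.
rewrite basic_imaginary_rootE; apply: (vertices_affine_polyhedron affA hd hLam).
- apply/(rational_weightsP affA hd hLam); exists (map_mx intr m), 0.
  by rewrite map_ratr_intmx rmorph0.
- exact: labels_lambda.
- by move=> i; rewrite mxE.
- exact: highest_root_untwisted htheta.
- by have := hreg (lshift l 0); rewrite mxE kE ltr0n.
Qed.
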